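(* The search problem Combinatorial Nullstellensatz over $\mathbb{F}_2$ is polynomially reducible to the search problem End of the Line. Consequently, Combinatorial Nullstellensatz over $\mathbb{F}_2$ is in PPA.
   Context: Problem Combinatorial Nullstellensatz over $\mathbb{F}_2$. Input: a polynomial $f$ in $m$ variables given in the form $f=\sum_{i=1}^{k}\big(\prod_{j=1}^{m_i}p_{ij}\big)$, where each $p_{ij}\in\mathbb{F}_2[x_1,\dots,x_m]$ is given explicitly as a sum of monomials, and $k$, the $m_i$ and the number of monomials of each $p_{ij}$ are polynomially bounded in $m$. It is assumed that $\sum_{j=1}^{m_i}\deg(p_{ij})\leq m$ for all $i$, and that there is a polynomial-time pairing function (part of the input) which pairs up all but one of the occurrences of the term $x_1x_2\cdots x_m$, proving that $\deg f=m$ and that the coefficient of $x_1x_2\cdots x_m$ in $f$ is nonzero. Here the terms of $f$ are the formal products obtained by choosing one monomial from each factor $p_{ij}$ ($j=1,\dots,m_i$) of some block $i$; a term is represented by the tuple $(i,a_{i,1},\dots,a_{i,m_i})$, where $a_{i,j}$ is the index of the chosen monomial of $p_{ij}$, and occurrences given by different tuples are regarded as different. Find: a vector $(s_1,\dots,s_m)\in\mathbb{F}_2^m$ with $f(s_1,\dots,s_m)\neq 0$. (As usual for such problems, if the input violates the assumptions, one may instead return a polynomial-size certificate of this: an index $i$ with $\sum_j\deg(p_{ij})>m$, or two occurrences of the term $x_1\cdots x_m$ at which the pairing function fails.) Problem End of the Line. For a finite undirected graph $G=(V,E)$, a pairing function is a function $\phi:V\times V\to V\cup\{*\}$ such that: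 if $vw$ is not an edge then $\phi(v,w)=*$; if $vw$ is an edge then $w'=\phi(v,w)$ is a node adjacent to $v$ and $\phi(v,\phi(v,w))=w$; and for every $v$ there is at most one node $w$ with $\phi(v,w)=w$. (So $\phi(v,\cdot)$ pairs up all neighbours of $v$ if $\deg v$ is even, and all but one if $\deg v$ is odd.) Input: a finite undirected graph $G=(V,E)$ with $V\subseteq\Sigma^n$ ($\Sigma$ a finite alphabet; $V$ may be exponentially large in $n$), whose edges are described by a pairing function $\phi$ computable by a given algorithm running in time polynomial in $n$; a node $\varepsilon$ of odd degree and a node $\delta$ with $\phi(\varepsilon,\delta)=\delta$. Find: another node $v\neq\varepsilon$ of odd degree together with a node $w$ such that $\phi(v,w)=w$. PPA (Polynomial Parity Argument) is the class of search problems that are polynomially reducible to End of the Line. A polynomial reduction of a search problem $A$ to a search problem $B$ consists of polynomial-time computable maps, one turning instances of $A$ into instances of $B$, the other turning every solution of the produced instance of $B$ into a solution of the original instance of $A$.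
   Formalization: The one occurrence of x_1...x_m left out by the pairing function is given as part of the input and must be a genuine occurrence; otherwise f = x_1 + x_1 with its two occurrences paired has neither a nonzero point nor a certificate. *)

(* Defs.v *)
From mathcomp Require Export all_boot all_order all_algebra.
From mathcomp Require Export mpoly.

Set Implicit Arguments.
Unset Strict Implicit.
Unset Printing Implicit Defensive.

Import GRing.Theory.

(* * The model of computation

   Programs act on binary trees.  Every step is charged at least the size of
   the trees it reads and writes (no sharing is assumed), so that running times
   are polynomially related to those of multitape Turing machines. *)

Inductive data : Type :=
  | DNil
  | DCons of data & data.

Fixpoint dsize (x : data) : nat :=
  if x is DCons a b then (dsize a + dsize b).+1 else 1.

Definition dhead (x : data) : data := if x is DCons a _ then a else DNil.
Definition dtail (x : data) : data := if x is DCons _ b then b else DNil.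

Definition dfalse : data := DNil.
Definition dtrue : data := DCons DNil DNil.

Inductive prog : Type :=
  | PId
  | PConst of data
  | PHead
  | PTail
  | PEq
  | PPair of prog & prog
  | PSeq of prog & prog
  | PIf of prog & prog & prog
  | PWhile of prog & prog.

(* [eval p x y t]: on input [x], [p] halts with output [y] after time [t].
   [DNil] is the only false value of a test. *)
Inductive eval : prog -> data -> data -> nat -> Prop :=
  | EvId x : eval PId x x (dsize x + dsize x)
  | EvConst c x : eval (PConst c) x c (dsize x + dsize c)
  | EvHead x : eval PHead x (dhead x) (dsize x + dsize (dhead x))
  | EvTail x : eval PTail x (dtail x) (dsize x + dsize (dtail x))
  | EvEqT x : dhead x = dtail x -> eval PEq x dtrue (dsize x + dsize dtrue)
  | EvEqF x : dhead x <> dtail x -> eval PEq x dfalse (dsize x + dsize dfalse)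
  | EvPair p q x y z t u :
      eval p x y t -> eval q x z u ->
      eval (PPair p q) x (DCons y z) (dsize x + t + u)
  | EvSeq p q x y z t u :
      eval p x y t -> eval q y z u ->
      eval (PSeq p q) x z (dsize x + t + u)
  | EvIfT c p q x b y t u :
      eval c x b t -> b <> DNil -> eval p x y u ->
      eval (PIf c p q) x y (dsize x + t + u)
  | EvIfF c p q x y t u :
      eval c x DNil t -> eval q x y u ->
      eval (PIf c p q) x y (dsize x + t + u)
  | EvWhileF c p x t :
      eval c x DNil t ->
      eval (PWhile c p) x x (dsize x + t)
  | EvWhileT c p x b y z t u v :
      eval c x b t -> b <> DNil -> eval p x y u -> eval (PWhile c p) y z v ->
      eval (PWhile c p) x z (dsize x + t + u + v).

Definition runs_in (p : prog) (x y : data) (T : nat) : Prop :=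
  exists2 t, eval p x y t & t <= T.

(* Numbers are written in unary. *)
Definition enc_nat (n : nat) : data := iter n (DCons DNil) DNil.

Definition enc_seq (T : Type) (e : T -> data) (s : seq T) : data :=
  foldr (fun a d => DCons (e a) d) DNil s.

Definition enc_option (T : Type) (e : T -> data) (o : option T) : data :=
  if o is Some a then DCons (e a) DNil else DNil.

Fixpoint enc_prog (p : prog) : data :=
  match p with
  | PId => DCons (enc_nat 0) DNil
  | PConst c => DCons (enc_nat 1) c
  | PHead => DCons (enc_nat 2) DNil
  | PTail => DCons (enc_nat 3) DNil
  | PEq => DCons (enc_nat 4) DNil
  | PPair p1 p2 => DCons (enc_nat 5) (DCons (enc_prog p1) (enc_prog p2))
  | PSeq p1 p2 => DCons (enc_nat 6) (DCons (enc_prog p1) (enc_prog p2))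
  | PIf c p1 p2 =>
      DCons (enc_nat 7) (DCons (enc_prog c) (DCons (enc_prog p1) (enc_prog p2)))
  | PWhile c p1 => DCons (enc_nat 8) (DCons (enc_prog c) (enc_prog p1))
  end.

(* * Search problems and polynomial reductions

   The instances of a problem are the [x] with [sp_valid x].  Complexity is
   measured on encodings; [sp_enc] may forget mathematical data (an
   exponentially large graph, say) that the encoded part describes. *)

Record search_problem : Type := SearchProblem {
  sp_inst : Type;
  sp_valid : sp_inst -> Prop;
  sp_enc : sp_inst -> data;
  sp_cand : sp_inst -> Type;
  sp_enc_cand : forall x : sp_inst, sp_cand x -> data;
  sp_solution : forall x : sp_inst, sp_cand x -> Prop
}.

(* [P] maps instances of [A] to instances of [B]; [Q] maps an instance of [A]
   together with a solution of the produced instance of [B] to a solution of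
   the instance of [A].  Polynomials bounding sizes and running times have
   natural coefficients. *)
Definition poly_reducible (A B : search_problem) : Prop :=
  exists (P Q : prog) (c : {poly nat}),
  forall x : sp_inst A, sp_valid x ->
  exists y : sp_inst B,
    [/\ sp_valid y,
        runs_in P (sp_enc x) (sp_enc y) (c.[dsize (sp_enc x)])%R
      & forall s : sp_cand y, sp_solution s ->
        exists s' : sp_cand x,
          sp_solution s' /\
          let z := DCons (sp_enc x) (sp_enc_cand s) in
          runs_in Q z (sp_enc_cand s') (c.[dsize z])%R].

(* * End of the Line *)

Section PairingFunction.
Variables (V : finType) (E : rel V) (phi : V -> V -> option V).

Definition degree (v : V) : nat := #|[set w | E v w]|.

(* [None] is the value "*". *)
Definition pairing_function : Prop :=
  [/\ forall v w, ~~ E v w -> phi v w = None,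
      forall v w, E v w ->
        exists w', [/\ phi v w = Some w', E v w' & phi v w' = Some w]
    & forall v w1 w2, phi v w1 = Some w1 -> phi v w2 = Some w2 -> w1 = w2].

End PairingFunction.

Definition word (sigma n : nat) : finType := n.-tuple 'I_sigma.

Definition enc_word (sigma n : nat) (w : word sigma n) : data :=
  enc_seq (fun a : 'I_sigma => enc_nat a) w.

(* [el_edge] and [el_phi] are extended to all words: a word outside [el_nodes]
   is in no edge, and [el_phi] is "*" there. *)
Record el_input (sigma : nat) : Type := ElInput {
  el_len : nat;
  el_nodes : {set word sigma el_len};
  el_edge : rel (word sigma el_len);
  el_phi : word sigma el_len -> word sigma el_len -> option (word sigma el_len);
  el_algo : prog;
  el_eps : word sigma el_len;
  el_delta : word sigma el_len
}.

Definition el_valid (sigma : nat) (r : {poly nat}) (G : el_input sigma) : Prop :=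
  [/\ [/\ irreflexive (@el_edge _ G), ssrbool.symmetric (@el_edge _ G)
        & forall v w, el_edge v w -> (v \in el_nodes G) && (w \in el_nodes G)],
      pairing_function (@el_edge _ G) (@el_phi _ G),
      forall v w : word sigma (el_len G),
        runs_in (el_algo G) (DCons (enc_word v) (enc_word w))
                (enc_option (@enc_word sigma (el_len G)) (el_phi v w))
                (r.[el_len G])%R
    & [/\ el_eps G \in el_nodes G, odd (degree (@el_edge _ G) (el_eps G)),
          el_delta G \in el_nodes G
        & el_phi (el_eps G) (el_delta G) = Some (el_delta G)]].

(* The graph is given by the algorithm for its pairing function only. *)
Definition el_enc (sigma : nat) (G : el_input sigma) : data :=
  DCons (enc_nat (el_len G))
    (DCons (enc_prog (el_algo G))
       (DCons (enc_word (el_eps G)) (enc_word (el_delta G)))).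

Definition el_cand (sigma : nat) (G : el_input sigma) : Type :=
  (word sigma (el_len G) * word sigma (el_len G))%type.

Definition el_enc_cand (sigma : nat) (G : el_input sigma) (s : el_cand G) : data :=
  DCons (enc_word s.1) (enc_word s.2).

Definition el_solution (sigma : nat) (G : el_input sigma) (s : el_cand G) : Prop :=
  [/\ s.1 \in el_nodes G, s.1 != el_eps G, odd (degree (@el_edge _ G) s.1)
    & el_phi s.1 s.2 = Some s.2].

(* The alphabet is ['I_sigma]; [r] bounds the running time of the algorithm for
   the pairing function in terms of the length of the words. *)
Definition end_of_the_line (sigma : nat) (r : {poly nat}) : search_problem :=
  @SearchProblem (el_input sigma) (@el_valid sigma r) (@el_enc sigma)
    (@el_cand sigma) (@el_enc_cand sigma) (@el_solution sigma).

Definition PPA (A : search_problem) : Prop :=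
  exists (sigma : nat) (r : {poly nat}),
    poly_reducible A (end_of_the_line sigma r).

(* * Combinatorial Nullstellensatz over F_2 *)

(* [(i, [:: a_0; ...])]: the monomials of index [a_j] are chosen from the
   factors of block [i]; all indices start from 0. *)
Definition term : Type := (nat * seq nat)%type.

Definition enc_term (t : term) : data :=
  DCons (enc_nat t.1) (enc_seq enc_nat t.2).

(* A factor is the list of its monomials.  [cn_exc] is the occurrence left out
   by the pairing function, a part of the data of the pairing. *)
Record cn_input : Type := CnInput {
  cn_m : nat;
  cn_blocks : seq (seq (seq 'X_{1..cn_m}));
  cn_pairing : prog;
  cn_exc : term
}.

Section CombinatorialNullstellensatz.
Variable x : cn_input.

Local Notation m := (cn_m x).

Definition cn_block (i : nat) : seq (seq 'X_{1..m}) := nth [::] (cn_blocks x) i.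

Definition factor_poly (p : seq 'X_{1..m}) : {mpoly 'F_2[m]} :=
  (\sum_(u <- p) 'X_[u])%R.

Definition cn_poly : {mpoly 'F_2[m]} :=
  (\sum_(b <- cn_blocks x) \prod_(p <- b) factor_poly p)%R.

Definition mdegree (p : {mpoly 'F_2[m]}) : nat := (msize p).-1.

(* The degree of the zero polynomial is minus infinity: a block with a zero
   factor does not exceed any degree. *)
Definition degree_exceeds (i : nat) : Prop :=
  [/\ i < size (cn_blocks x),
      all (fun p => factor_poly p != 0%R) (cn_block i)
    & m < \sum_(p <- cn_block i) mdegree (factor_poly p)].

Definition is_term (t : term) : Prop :=
  [/\ t.1 < size (cn_blocks x), size t.2 = size (cn_block t.1)
    & forall j, j < size (cn_block t.1) ->
        nth 0 t.2 j < size (nth [::] (cn_block t.1) j)].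

Definition term_monomial (t : term) : 'X_{1..m} :=
  \big[@mnm_add m/@mnm0 m]_(j < size (cn_block t.1))
     nth (@mnm0 m) (nth [::] (cn_block t.1) j) (nth 0 t.2 j).

(* The occurrences of x_1 x_2 ... x_m. *)
Definition occurrence (t : term) : Prop :=
  is_term t /\ term_monomial t = [multinom 1 | _ < m].

(* [t] is sent to another occurrence, different from the exceptional one; any
   other output leaves [t] unpaired. *)
Definition paired_to (t t' : term) : Prop :=
  [/\ occurrence t', t' <> t, t' <> cn_exc x
    & exists n, eval (cn_pairing x) (enc_term t) (enc_term t') n].

(* Either both [t] and the exceptional occurrence [t'] are left unpaired, or [t]
   is paired to [t'] but not conversely. *)
Definition pairing_failure (t t' : term) : Prop :=
  [/\ occurrence t, occurrence t', t <> t', t <> cn_exc x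
    & (t' = cn_exc x /\ ~ exists t'', paired_to t t'') \/
      (paired_to t t' /\ ~ paired_to t' t)].

(* [q] bounds the number of blocks, of factors, of monomials, and the running
   time of the pairing function, in terms of the number of variables.  The
   degree bound and the correctness of the pairing are not required here:
   their violations are accepted as solutions. *)
Definition cn_valid (q : {poly nat}) : Prop :=
  [/\ (size (cn_blocks x) <= q.[m]%R) /\
      (forall b, b \in cn_blocks x -> (size b <= q.[m]%R)),
      forall b p, b \in cn_blocks x -> p \in b -> uniq p /\ size p <= q.[m]%R,
      forall t, occurrence t ->
        exists d, runs_in (cn_pairing x) (enc_term t) d q.[m]%R
    & occurrence (cn_exc x)].

(* Exponents are written in unary; [cn_exc] and the source of the algorithm
   are part of the input. *)
Definition cn_enc : data :=
  DCons (enc_nat m)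
    (DCons
       (enc_seq (enc_seq (enc_seq (fun u : 'X_{1..m} => enc_seq enc_nat u)))
          (cn_blocks x))
       (DCons (enc_prog (cn_pairing x)) (enc_term (cn_exc x)))).

Inductive cn_cand : Type :=
  | NonzeroPoint of m.-tuple 'F_2
  | DegreeViolation of nat
  | PairingViolation of term & term.

Definition cn_enc_cand (s : cn_cand) : data :=
  match s with
  | NonzeroPoint v =>
      DCons (enc_nat 0) (enc_seq (fun a : 'F_2 => enc_nat (val a)) v)
  | DegreeViolation i => DCons (enc_nat 1) (enc_nat i)
  | PairingViolation t t' =>
      DCons (enc_nat 2) (DCons (enc_term t) (enc_term t'))
  end.

Definition cn_solution (s : cn_cand) : Prop :=
  match s with
  | NonzeroPoint v => cn_poly.@[tnth v] <> 0%R
  | DegreeViolation i => degree_exceeds i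
  | PairingViolation t t' => pairing_failure t t'
  end.

End CombinatorialNullstellensatz.

Definition comb_nullstellensatz_F2 (q : {poly nat}) : search_problem :=
  @SearchProblem cn_input (fun x => cn_valid x q) cn_enc cn_cand
    cn_enc_cand cn_solution.

(* Main.v *)
(* Following Varga: take as vertices the points of F_2^m and the terms, joining
   a point to the terms that do not vanish at it.  A point has odd degree iff f is
   nonzero there.  A term with a variable missing is joined to an even number of
   points, a term with full support only to the point (1, ..., 1).  Hence a term of
   odd degree exceeds the degree bound or is an occurrence of x_1...x_m, and the
   latter are paired by extra edges that follow the given pairing; if t is sent to
   t' but t' not back to t, an extra leaf joined to t records the failure.  The
   exceptional occurrence remains as the known vertex of odd degree.

   The neighbours of a point are a disjoint union of products of lists, those of a
   term a product of lists.  In a product one changes the first coordinate that its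
   own list does not leave alone, so that at most one tuple, the tuple of last
   entries of lists of odd length, is left alone; the tuples left alone in
   different blocks are then paired among themselves.

   The algorithm of the pairing function of the graph contains the given pairing
   program as a subprogram, so no interpreter for programs is needed; it is called
   at most twice, and only at occurrences, where it is known to halt. *)
From HB Require Import structures.
Require Import Defs.
From mathcomp Require Import zify.
From Stdlib Require Import ClassicalEpsilon.

Set Implicit Arguments.
Unset Strict Implicit.
Unset Printing Implicit Defensive.

Import GRing.Theory.

(** * Running times bounded by polynomials *)

(** The time of the graph algorithm must be bounded by one polynomial in the word length, the same
    for all instances, although each algorithm contains its instance as a constant and a foreign
    program. Hence running times are studied for families of programs indexed by instances
    ([runs_poly]), and words are made longer than the encoded instance. All words have one fixed
    length and every word may be queried, so vertices are serialized and padded, and a word that is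
    not exactly such a padding becomes an isolated node. The given program may diverge outside the
    occurrences, so it cannot be treated as a polynomial-time function. Everything else is a
    function on lists, proved to be in [ptime] from its syntax, and the program enters only through
    an answer function [ans]; the list functions receive at most two of its answers as arguments. A
    solution is translated by classifying directly the vertices [v] with [phi v w = Some w]: a
    nonzero point, a term of full support without link, or a leaf. *)

Lemma data_eq_dec : comparable data.
Proof. by move=> x y; rewrite /decidable; decide equality. Qed.

HB.instance Definition _ := hasDecEq.Build data (compareP data_eq_dec).

Lemma dsize_gt0 (d : data) : 0 < dsize d.
Proof. by case: d. Qed.

(** Every rule charges for what it reads and writes. Hence a polynomial time bound also bounds all
    intermediate data, which is what makes composition of polynomial-time programs polynomial. *)
Lemma eval_time (p : prog) (x y : data) (t : nat) :
  eval p x y t -> dsize x <= t /\ dsize y <= t.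
Proof.
elim=> {p x y t} [x|c' x|x|x|x _|x _|p' q x y' z t' u _ IHp _ IHq|p' q x y' z t' u _ IHp _ IHq
  |c p' q x b y' t' u _ IHc _ _ IHp|c p' q x y' t' u _ IHc _ IHq|c p' x t' _ IHc
  |c p' x b y' z t' u v _ IHc _ _ IHp _ IHw];
  have := dsize_gt0 x; rewrite /=; lia.
Qed.

(** Needed to speak of the output of the given pairing program at a term. *)
Lemma eval_det (p : prog) (x y y' : data) (t t' : nat) :
  eval p x y t -> eval p x y' t' -> y = y'.
Proof.
move=> e; elim: e y' t' => {p x y t}.
1-4: by move=> *; match goal with H : eval _ _ _ _ |- _ => inversion H end.
- by move=> x Ex y' t' e; inversion e.
- by move=> x Ex y' t' e; inversion e.
- move=> p q x y z t u _ IHp _ IHq y' t' e; inversion e; subst.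
  by congr DCons; [apply: IHp; eassumption | apply: IHq; eassumption].
- move=> p q x y z t u _ IHp _ IHq y' t' e; inversion e; subst.
  apply: IHq; have -> : y = y0 by apply: IHp; eassumption.
  eassumption.
- move=> c p q x b y t u _ IHc nb _ IHp y' t' e; inversion e; subst.
    by apply: IHp; eassumption.
  by case: nb; apply: IHc; eassumption.
- move=> c p q x y t u _ IHc _ IHq y' t' e; inversion e; subst.
    have Eb : DNil = b by apply: IHc; eassumption.
    by subst b.
  by apply: IHq; eassumption.
- move=> c p x t _ IHc y' t' e; inversion e; subst=> //.
  have Eb : DNil = b by apply: IHc; eassumption.
  by subst b.
- move=> c p x b y z t u v _ IHc nb _ IHp _ IHw y' t' e; inversion e; subst.
    by case: nb; apply: IHc; eassumption.
  apply: IHw; have -> : y = y0 by apply: IHp; eassumption.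
  eassumption.
Qed.

(** Evaluation is restated with the operations of [nat] in place of the ring operations, so that
    [lia] applies after rewriting. *)
Section HornerNat.
Variables (c d : {poly nat}) (n : nat).

Lemma horner_natD : ((c + d)%R.[n])%R = (c.[n])%R + (d.[n])%R.
Proof. exact: hornerD. Qed.

Lemma horner_natM : ((c * d)%R.[n])%R = (c.[n])%R * (d.[n])%R.
Proof. exact: hornerM. Qed.

Lemma horner_natC (k : nat) : (k%:P.[n])%R = k.
Proof. exact: hornerC. Qed.

Lemma horner_nat_comp : ((c \Po d).[n])%R = (c.[d.[n]])%R.
Proof. exact: horner_comp. Qed.

End HornerNat.

Section PolynomialBounds.
Variables (I : Type) (D : I -> Prop) (len : I -> nat).

Lemma horner_nat_mono (c : {poly nat}) (m n : nat) :
  m <= n -> (c.[m])%R <= (c.[n])%R.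
Proof.
move=> le_mn; elim/poly_ind: c => [|c a IH]; first by rewrite !horner0.
by rewrite !hornerMXaddC; apply: leq_add => //; apply: leq_mul.
Qed.

Definition poly_bounded (f : I -> nat) : Prop :=
  exists c : {poly nat}, forall i, D i -> f i <= (c.[len i])%R.

Lemma pbounded_le (f g : I -> nat) :
  (forall i, D i -> f i <= g i) -> poly_bounded g -> poly_bounded f.
Proof.
by move=> le_fg [c cP]; exists c => i Di; apply: leq_trans (cP i Di); apply: le_fg.
Qed.

Lemma pbounded_len : poly_bounded len.
Proof. by exists 'X%R => i _; rewrite hornerX. Qed.

Lemma pbounded_const (k : nat) : poly_bounded (fun=> k).
Proof. by exists (k%:P)%R => i _; rewrite hornerC. Qed.

Lemma pbounded_add (f g : I -> nat) :
  poly_bounded f -> poly_bounded g -> poly_bounded (fun i => f i + g i).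
Proof.
move=> [c cP] [d dP]; exists (c + d)%R => i Di.
by rewrite hornerD; apply: leq_add; [apply: cP | apply: dP].
Qed.

Lemma pbounded_mul (f g : I -> nat) :
  poly_bounded f -> poly_bounded g -> poly_bounded (fun i => f i * g i).
Proof.
move=> [c cP] [d dP]; exists (c * d)%R => i Di.
by rewrite hornerM; apply: leq_mul; [apply: cP | apply: dP].
Qed.

Lemma pbounded_horner (d : {poly nat}) (f : I -> nat) :
  poly_bounded f -> poly_bounded (fun i => d.[f i])%R.
Proof.
move=> [c cP]; exists (d \Po c)%R => i Di.
by rewrite horner_comp; apply: horner_nat_mono; apply: cP.
Qed.

(** The program may vary with [i], but the polynomial bounding [T] may not: this is the uniformity
    required of the graph algorithms, which differ from instance to instance. *)
Definition runs_poly (p : I -> prog) (x y : I -> data) : Prop :=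
  exists2 T, poly_bounded T & forall i, D i -> runs_in (p i) (x i) (y i) (T i).

Lemma runs_poly_in p x y : runs_poly p x y -> poly_bounded (fun i => dsize (x i)).
Proof.
case=> T bT TP; apply: pbounded_le bT => i Di.
by have [t /eval_time[le_t _] /(leq_trans le_t)] := TP i Di.
Qed.

Lemma runs_poly_out p x y : runs_poly p x y -> poly_bounded (fun i => dsize (y i)).
Proof.
case=> T bT TP; apply: pbounded_le bT => i Di.
by have [t /eval_time[_ le_t] /(leq_trans le_t)] := TP i Di.
Qed.

Lemma runs_poly_eq p x y y' :
  (forall i, D i -> y i = y' i) -> runs_poly p x y -> runs_poly p x y'.
Proof. by move=> Ey [T bT TP]; exists T => // i Di; rewrite -Ey //; apply: TP. Qed.

Lemma runs_poly_id x :
  poly_bounded (fun i => dsize (x i)) -> runs_poly (fun=> PId) x x.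
Proof.
move=> bx; exists (fun i => dsize (x i) + dsize (x i)).
  exact: pbounded_add.
by move=> i _; eexists; first exact: EvId.
Qed.

Lemma runs_poly_const x d :
  poly_bounded (fun i => dsize (x i)) -> poly_bounded (fun i => dsize (d i)) ->
  runs_poly (fun i => PConst (d i)) x d.
Proof.
move=> bx bd; exists (fun i => dsize (x i) + dsize (d i)).
  exact: pbounded_add.
by move=> i _; eexists; first exact: EvConst.
Qed.

Lemma runs_poly_head x :
  poly_bounded (fun i => dsize (x i)) ->
  runs_poly (fun=> PHead) x (fun i => dhead (x i)).
Proof.
move=> bx; exists (fun i => dsize (x i) + dsize (x i)); first exact: pbounded_add.
move=> i _; eexists; first exact: EvHead.
by rewrite leq_add2l; case: (x i) => //= a b; lia.
Qed.

Lemma runs_poly_tail x :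
  poly_bounded (fun i => dsize (x i)) ->
  runs_poly (fun=> PTail) x (fun i => dtail (x i)).
Proof.
move=> bx; exists (fun i => dsize (x i) + dsize (x i)); first exact: pbounded_add.
move=> i _; eexists; first exact: EvTail.
by rewrite leq_add2l; case: (x i) => //= a b; lia.
Qed.

Lemma runs_poly_eqtest x :
  poly_bounded (fun i => dsize (x i)) ->
  runs_poly (fun=> PEq) x
    (fun i => if dhead (x i) == dtail (x i) then dtrue else dfalse).
Proof.
move=> bx; exists (fun i => dsize (x i) + 3).
  by apply: pbounded_add => //; exact: pbounded_const.
move=> i _; case: eqP => Ex; eexists; [exact: EvEqT | by [] | exact: EvEqF | ].
by rewrite leq_add2l.
Qed.

Lemma runs_poly_pair p q x y z :
  runs_poly p x y -> runs_poly q x z ->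
  runs_poly (fun i => PPair (p i) (q i)) x (fun i => DCons (y i) (z i)).
Proof.
move=> rp rq; have bx := runs_poly_in rp.
case: rp rq => T bT TP [U bU UP].
exists (fun i => dsize (x i) + T i + U i); first by do 2?apply: pbounded_add => //.
move=> i Di; have [t et le_t] := TP i Di; have [u eu le_u] := UP i Di.
by eexists; [apply: EvPair; eassumption | lia].
Qed.

Lemma runs_poly_seq p q x y z :
  runs_poly p x y -> runs_poly q y z ->
  runs_poly (fun i => PSeq (p i) (q i)) x z.
Proof.
move=> rp rq; have bx := runs_poly_in rp.
case: rp rq => T bT TP [U bU UP].
exists (fun i => dsize (x i) + T i + U i); first by do 2?apply: pbounded_add => //.
move=> i Di; have [t et le_t] := TP i Di; have [u eu le_u] := UP i Di.
by eexists; [apply: EvSeq; eassumption | lia].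
Qed.

End PolynomialBounds.

Lemma runs_poly_if (I : Type) (D : I -> Prop) (len : I -> nat)
    (c p q : I -> prog) (x b y : I -> data) :
  runs_poly D len c x b ->
  runs_poly (fun i => D i /\ b i <> DNil) len p x y ->
  runs_poly (fun i => D i /\ b i = DNil) len q x y ->
  runs_poly D len (fun i => PIf (c i) (p i) (q i)) x y.
Proof.
move=> rc; have bx := runs_poly_in rc.
case: rc => T bT TP [U [cU bU] UP] [W [cW bW] WP].
(* [U] and [W] are bounded only on their own branches; the polynomials bounding them make sense
   everywhere, so their sum serves both branches. *)
exists (fun i => dsize (x i) + T i + (cU.[len i] + cW.[len i])%R).
  apply: pbounded_add; first exact: pbounded_add.
  by apply: pbounded_add; apply: pbounded_horner; apply: pbounded_len.
move=> i Di; have [t et le_t] := TP i Di.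
have [Eb|/eqP nb] := eqVneq (b i) DNil.
  have [u eu le_u] := WP i (conj Di Eb); have := bW i (conj Di Eb).
  rewrite Eb in et; move=> le_W; eexists; first by apply: EvIfF; eassumption.
  rewrite leq_add ?leq_add // ; apply: leq_trans le_u _; apply: leq_trans le_W _.
  exact: leq_addl.
have [u eu le_u] := UP i (conj Di nb); have le_U := bU i (conj Di nb).
eexists; first by apply: EvIfT; eassumption.
rewrite leq_add ?leq_add //; apply: leq_trans le_u _; apply: leq_trans le_U _.
exact: leq_addr.
Qed.

(** A round costs the size of the state, the test and the body. The test has read the state, so its
    time bounds that size too, whence the factor 3; the last, failing test accounts for [k.+1]. *)
Lemma runs_while (c p : prog) (st : nat -> data) (k U : nat) :
  (forall j, j < k -> exists2 b, b <> DNil & runs_in c (st j) b U) ->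
  (forall j, j < k -> runs_in p (st j) (st j.+1) U) ->
  runs_in c (st k) DNil U ->
  runs_in (PWhile c p) (st 0) (st k) (k.+1 * (3 * U)).
Proof.
elim: k st => [|k IH] st cT pT cF.
  have [t et le_t] := cF; have [le_x _] := eval_time et.
  by eexists; [apply: EvWhileF; eassumption | lia].
have [b nb [t et le_t]] := cT 0 isT; have [u eu le_u] := pT 0 isT.
have [le_x _] := eval_time et.
have [j lt_jk|j lt_jk|//|v ev le_v] := IH (fun j => st j.+1).
- exact: (cT j.+1).
- exact: (pT j.+1).
by eexists; [apply: EvWhileT; eassumption | lia].
Qed.

(** * Types with injective encodings and polynomial-time functions between them *)

HB.mixin Record HasEncoding T of Equality T := {
  enc : T -> data;
  enc_inj : injective enc
}.

#[short(type="encType")]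
HB.structure Definition Encoding := { T of HasEncoding T & Equality T }.

HB.instance Definition _ := HasEncoding.Build data (@inj_id data).

Lemma enc_nat_inj : injective enc_nat.
Proof. by elim=> [|n IH] [|m] //= [/IH->]. Qed.

HB.instance Definition _ := HasEncoding.Build nat enc_nat_inj.

Definition enc_bool (b : bool) : data := if b then dtrue else dfalse.

Lemma enc_bool_inj : injective enc_bool.
Proof. by do 2!case. Qed.

HB.instance Definition _ := HasEncoding.Build bool enc_bool_inj.

(** With [DNil] for [tt], the number [n.+1] is encoded like [(tt, n)], [Some a] like [(a, tt)], and
    [n] like the list of [n] copies of [tt]; case analysis and loops on numbers thus reduce to pairs
    and lists. *)
Lemma enc_unit_inj : injective (fun _ : unit => DNil).
Proof. by do 2!case. Qed.

HB.instance Definition _ := HasEncoding.Build unit enc_unit_inj.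

Section Containers.
Variables A B : encType.

Definition enc_pair (z : A * B) : data := DCons (enc z.1) (enc z.2).

Lemma enc_pair_inj : injective enc_pair.
Proof. by move=> [a b] [a' b'] [/enc_inj-> /enc_inj->]. Qed.

HB.instance Definition _ := HasEncoding.Build (A * B)%type enc_pair_inj.

Lemma enc_seq_inj : injective (enc_seq (@enc A)).
Proof. by elim=> [|a s IH] [|b s'] //= [/enc_inj-> /IH->]. Qed.

HB.instance Definition _ := HasEncoding.Build (seq A) enc_seq_inj.

Lemma enc_option_inj : injective (enc_option (@enc A)).
Proof. by move=> [a|] [b|] //= [/enc_inj->]. Qed.

HB.instance Definition _ := HasEncoding.Build (option A) enc_option_inj.

End Containers.

(* An inductive wrapper, so that unification does not unfold it. *)
Variant ptime (A B : encType) (f : A -> B) : Prop :=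
  PTime p of runs_poly (fun=> True) (fun x => dsize (enc x))
               (fun=> p) (fun x => enc x) (fun x => enc (f x)).

(** The program is fixed before the family, so it can be a part of programs that depend on the
    instance. *)
Lemma ptime_runs (A B : encType) (f : A -> B) : ptime f ->
  exists p, forall (I : Type) (D : I -> Prop) (len : I -> nat) (x : I -> A),
    poly_bounded D len (fun i => dsize (enc (x i))) ->
    runs_poly D len (fun=> p) (fun i => enc (x i)) (fun i => enc (f (x i))).
Proof.
case=> p [T [c cP] TP]; exists p => I D len x bx.
exists (fun i => c.[dsize (enc (x i))])%R; first exact: pbounded_horner.
move=> i Di; have [t et le_t] := TP (x i) Logic.I.
by exists t => //; apply: leq_trans le_t _; apply: cP.
Qed.

Lemma ptime_bounded (A B : encType) (f : A -> B) : ptime f ->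
  poly_bounded (fun=> True) (fun x => dsize (enc x)) (fun x => dsize (enc (f x))).
Proof. by case=> p /runs_poly_out. Qed.

Lemma dsize_enc_bounded (A : encType) :
  poly_bounded (fun=> True) (fun x : A => dsize (enc x)) (fun x => dsize (enc x)).
Proof. exact: pbounded_len. Qed.
Hint Resolve dsize_enc_bounded : core.

Section Basics.
Variable A : encType.
Implicit Types B C : encType.

Lemma eq_ptime B (f g : A -> B) : f =1 g -> ptime f -> ptime g.
Proof.
by move=> Efg [p rp]; exists p; apply: runs_poly_eq rp => x _; rewrite Efg.
Qed.

Lemma ptime_id : ptime (fun x : A => x).
Proof. by exists PId; apply: runs_poly_id. Qed.

Lemma ptime_const B (b : B) : ptime (fun _ : A => b).
Proof.
by exists (PConst (enc b)); apply: runs_poly_const => //; exact: pbounded_const.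
Qed.

Lemma ptime_comp B C (g : B -> C) (f : A -> B) :
  ptime g -> ptime f -> ptime (fun x => g (f x)).
Proof.
move=> /ptime_runs[q rq] [p rp]; exists (PSeq p q).
by apply: runs_poly_seq rp (rq _ _ _ _ (runs_poly_out rp)).
Qed.

Lemma ptime_pair B C (f : A -> B) (g : A -> C) :
  ptime f -> ptime g -> ptime (fun x => (f x, g x)).
Proof. by move=> [p rp] [q rq]; exists (PPair p q); apply: runs_poly_pair. Qed.

Lemma ptime_comp2 B C (E : encType) (h : B -> C -> E) (f : A -> B) (g : A -> C) :
  ptime (fun z => h z.1 z.2) -> ptime f -> ptime g -> ptime (fun x => h (f x) (g x)).
Proof. by move=> ph pf pg; exact: ptime_comp ph (ptime_pair pf pg). Qed.

Lemma ptime_comp3 B C (E F : encType) (h : B -> C -> E -> F)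
    (f : A -> B) (g : A -> C) (k : A -> E) :
  ptime (fun z => h z.1.1 z.1.2 z.2) -> ptime f -> ptime g -> ptime k ->
  ptime (fun x => h (f x) (g x) (k x)).
Proof.
by move=> ph pf pg pk; exact: ptime_comp ph (ptime_pair (ptime_pair pf pg) pk).
Qed.

Lemma ptime_fst B C (f : A -> B * C) : ptime f -> ptime (fun x => (f x).1).
Proof.
move=> [p rp]; exists (PSeq p PHead).
by apply: runs_poly_seq rp (runs_poly_head (runs_poly_out rp)).
Qed.

Lemma ptime_snd B C (f : A -> B * C) : ptime f -> ptime (fun x => (f x).2).
Proof.
move=> [p rp]; exists (PSeq p PTail).
by apply: runs_poly_seq rp (runs_poly_tail (runs_poly_out rp)).
Qed.

Lemma ptime_enc B (f : A -> B) : ptime f -> ptime (fun x => enc (f x)).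
Proof. by case=> p rp; exists p. Qed.

Lemma ptime_DCons (f g : A -> data) :
  ptime f -> ptime g -> ptime (fun x => DCons (f x) (g x)).
Proof. by move=> [p rp] [q rq]; exists (PPair p q); apply: runs_poly_pair. Qed.

Lemma ptime_cons B (f : A -> B) (g : A -> seq B) :
  ptime f -> ptime g -> ptime (fun x => f x :: g x).
Proof. by move=> [p rp] [q rq]; exists (PPair p q); apply: runs_poly_pair. Qed.

Lemma ptime_Some B (f : A -> B) : ptime f -> ptime (fun x => Some (f x)).
Proof.
move=> [p rp]; exists (PPair p (PConst DNil)); apply: (runs_poly_pair rp).
apply: (runs_poly_const (d := fun=> DNil)); first exact: runs_poly_in rp.
exact: pbounded_const.
Qed.

Lemma ptime_succn (f : A -> nat) : ptime f -> ptime (fun x => (f x).+1).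
Proof.
move=> [p rp]; exists (PPair (PConst DNil) p); apply: runs_poly_pair rp.
by apply: (runs_poly_const (d := fun=> DNil)) => //; exact: pbounded_const.
Qed.

Lemma ptime_nseq_unit (f : A -> nat) : ptime f -> ptime (fun x => nseq (f x) tt).
Proof.
move=> [p rp]; exists p; apply: runs_poly_eq rp => x _.
by rewrite /enc /=; elim: (f x) => //= n ->.
Qed.

(** Trees are compared instead of values; injectivity of encodings makes the two tests agree. *)
Lemma ptime_eq B (f g : A -> B) : ptime f -> ptime g -> ptime (fun x => f x == g x).
Proof.
move=> [p rp] [q rq]; exists (PSeq (PPair p q) PEq).
have rpq := runs_poly_pair rp rq.
apply: (runs_poly_seq rpq).
apply: (runs_poly_eq _ (runs_poly_eqtest (runs_poly_out rpq))) => x _ /=.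
by rewrite (inj_eq (@enc_inj B)) /=; case: eqP.
Qed.

Lemma runs_poly_sub (I : Type) (D D' : I -> Prop) (len : I -> nat) p x y :
  (forall i, D' i -> D i) -> runs_poly D len p x y -> runs_poly D' len p x y.
Proof.
move=> sD [T [c cP] TP]; exists T; first by exists c => i /sD; apply: cP.
by move=> i /sD; apply: TP.
Qed.

Lemma ptime_if B (b : A -> bool) (f g : A -> B) :
  ptime b -> ptime f -> ptime g -> ptime (fun x => if b x then f x else g x).
Proof.
move=> [c rc] [p rp] [q rq]; exists (PIf c p q).
apply: (runs_poly_if rc).
  apply: (runs_poly_eq (y := fun x => enc (f x))); last exact: runs_poly_sub rp.
  by move=> x [_]; case: (b x).
apply: (runs_poly_eq (y := fun x => enc (g x))); last exact: runs_poly_sub rq.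
by move=> x [_]; case: (b x).
Qed.

(* The encoding of a nonempty list, a positive number, a [Some] or a [DCons] is
   also the encoding of the tuple of the arguments of the constructor. *)
Lemma ptime_case B C (p : prog) (b : A -> data) (arg : A -> option B)
    (f : A -> C) (g : A * B -> C) :
  runs_poly (fun=> True) (fun x : A => dsize (enc x)) (fun=> p) (fun x => enc x) b ->
  (forall x a, arg x = Some a -> b x = enc a) ->
  (forall x, arg x = None <-> b x = DNil) ->
  ptime f -> ptime g ->
  ptime (fun x => if arg x is Some a then g (x, a) else f x).
Proof.
move=> rb argS argN [pf rf] /ptime_runs[pg rg]; exists (PIf p (PSeq (PPair PId p) pg) pf).
apply: (runs_poly_if rb); last first.
  apply: (runs_poly_eq (y := fun x => enc (f x))); last exact: runs_poly_sub rf.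
  by move=> x [_ /argN->].
(* The branch is analysed on pairs of an input with its argument, while the length stays that of the
   input alone. *)
pose D (z : A * B) := arg z.1 = Some z.2.
have rz : runs_poly D (fun z => dsize (enc z.1)) (fun=> PSeq (PPair PId p) pg)
    (fun z => enc z.1) (fun z => enc (g z)).
  have rpair : runs_poly D (fun z => dsize (enc z.1)) (fun=> PPair PId p)
      (fun z => enc z.1) (fun z => enc z).
    apply: (runs_poly_eq (y := fun z => DCons (enc z.1) (b z.1))).
      by move=> [x a] Dz; rewrite (argS _ _ Dz).
    apply: runs_poly_pair; first by apply: runs_poly_id; exact: pbounded_len.
    have [T [c cP] TP] := rb; exists (fun z => T z.1).
      by exists c => z _; apply: cP.
    by move=> z _; apply: TP.
  exact: runs_poly_seq rpair (rg _ _ _ _ (runs_poly_out rpair)).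
have [T [c cP] TP] := rz.
exists (fun x => c.[dsize (enc x)])%R; first by exists c.
move=> x [_ nb]; case Da: (arg x) => [a|]; last by case: nb; apply/argN.
have [t et le_t] := TP (x, a) Da; exists t => //.
exact: leq_trans le_t (cP (x, a) Da).
Qed.

End Basics.

Section Cases.
Variables (A B C : encType).

Lemma ptime_case_seq (l : A -> seq B) (f : A -> C) (g : A -> B -> seq B -> C) :
  ptime l -> ptime f -> ptime (fun z : A * (B * seq B) => g z.1 z.2.1 z.2.2) ->
  ptime (fun x => if l x is a :: l' then g x a l' else f x).
Proof.
move=> [p rl] pf pg.
pose arg x := if l x is a :: l' then Some (a, l') else None.
have argS x a : arg x = Some a -> enc (l x) = enc a.
  by rewrite /arg; case: (l x) => [|b s] // [<-].
have argN x : arg x = None <-> enc (l x) = DNil.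
  by rewrite /arg; case: (l x) => *; split.
have H := ptime_case (arg := arg) rl argS argN pf pg.
apply: eq_ptime H => x.
by rewrite /arg; case: (l x).
Qed.

Lemma ptime_case_nat (n : A -> nat) (f : A -> C) (g : A -> nat -> C) :
  ptime n -> ptime f -> ptime (fun z : A * nat => g z.1 z.2) ->
  ptime (fun x => if n x is k.+1 then g x k else f x).
Proof.
move=> pn pf pg.
have pg' : ptime (fun z : A * (unit * nat) => g z.1 z.2.2).
  apply: ptime_comp2 => //; first exact: ptime_fst (ptime_id _).
  exact: ptime_snd (ptime_snd (ptime_id _)).
have [p rn] := pn.
pose arg x := if n x is k.+1 then Some (tt, k) else None.
have argS x a : arg x = Some a -> enc (n x) = enc a.
  by rewrite /arg; case: (n x) => [|k] // [<-].
have argN x : arg x = None <-> enc (n x) = DNil.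
  by rewrite /arg; case: (n x) => *; split.
have H := ptime_case (arg := arg) rn argS argN pf pg'.
apply: eq_ptime H => x.
by rewrite /arg; case: (n x).
Qed.

Lemma ptime_case_option (o : A -> option B) (f : A -> C) (g : A -> B -> C) :
  ptime o -> ptime f -> ptime (fun z : A * B => g z.1 z.2) ->
  ptime (fun x => if o x is Some a then g x a else f x).
Proof.
move=> po pf pg.
have pg' : ptime (fun z : A * (B * unit) => g z.1 z.2.1).
  apply: ptime_comp2 => //; first exact: ptime_fst (ptime_id _).
  exact: ptime_fst (ptime_snd (ptime_id _)).
have [p ro] := po.
pose arg x := if o x is Some a then Some (a, tt) else None.
have argS x a : arg x = Some a -> enc (o x) = enc a.
  by rewrite /arg; case: (o x) => [b|] // [<-].
have argN x : arg x = None <-> enc (o x) = DNil.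
  by rewrite /arg; case: (o x) => *; split.
have H := ptime_case (arg := arg) ro argS argN pf pg'.
apply: eq_ptime H => x.
by rewrite /arg; case: (o x).
Qed.

Lemma ptime_case_data (d : A -> data) (f : A -> C) (g : A -> data -> data -> C) :
  ptime d -> ptime f -> ptime (fun z : A * (data * data) => g z.1 z.2.1 z.2.2) ->
  ptime (fun x => if d x is DCons a b then g x a b else f x).
Proof.
move=> [p rd] pf pg.
pose arg x := if d x is DCons a b then Some (a, b) else None.
have argS x a : arg x = Some a -> enc (d x) = enc a.
  by rewrite /arg; case: (d x) => [|d1 d2] // [<-].
have argN x : arg x = None <-> enc (d x) = DNil.
  by rewrite /arg; case: (d x) => *; split.
have H := ptime_case (arg := arg) rd argS argN pf pg.
apply: eq_ptime H => x.
by rewrite /arg; case: (d x).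
Qed.

End Cases.

(** Only the states actually reached are required to have polynomial size. The polynomial bound of
    [step] alone would not do, since its iterates need not stay polynomial. *)
Lemma ptime_while (A S : encType) (init : A -> S) (cond : S -> bool)
    (step : S -> S) (k : A -> nat) (c : {poly nat}) :
  ptime init -> ptime cond -> ptime step ->
  (forall x, k x <= (c.[dsize (enc x)])%R) ->
  (forall x j, j <= k x ->
     dsize (enc (iter j step (init x))) <= (c.[dsize (enc x)])%R) ->
  (forall x j, j < k x -> cond (iter j step (init x))) ->
  (forall x, ~~ cond (iter (k x) step (init x))) ->
  ptime (fun x => iter (k x) step (init x)).
Proof.
move=> [p rp] [q [T [cT bT] TP]] [s [U [cU bU] UP]] le_k le_sz condT condF.
exists (PSeq p (PWhile q s)); apply: runs_poly_seq rp _.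
pose W (x : A) := ((cT + cU)%R \Po c).[dsize (enc x)]%R.
exists (fun x => (c.[dsize (enc x)]%R + 1) * (3 * W x)).
  apply: pbounded_mul; [apply: pbounded_add | apply: pbounded_mul];
    by [apply: pbounded_const | apply: pbounded_horner; apply: pbounded_len].
have leW x j : j <= k x -> (cT.[dsize (enc (iter j step (init x)))] +
    cU.[dsize (enc (iter j step (init x)))])%R <= W x.
  move=> le_j; rewrite /W horner_comp hornerD.
  by apply: leq_add; apply: horner_nat_mono; apply: le_sz.
move=> x _.
have [|||t et le_t] := @runs_while q s (fun j => enc (iter j step (init x))) (k x) (W x).
- move=> j lt_j; have [t et le_t] := TP (iter j step (init x)) Logic.I.
  exists dtrue => //; exists t; first by rewrite condT in et.
  have := leW x j (ltnW lt_j); have := bT (iter j step (init x)) Logic.I.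
  by rewrite !natrDE; lia.
- move=> j lt_j; have [t et le_t] := UP (iter j step (init x)) Logic.I.
  exists t; first by rewrite iterS.
  have := leW x j (ltnW lt_j); have := bU (iter j step (init x)) Logic.I.
  by rewrite !natrDE; lia.
- have [t et le_t] := TP (iter (k x) step (init x)) Logic.I.
  exists t; first by rewrite (negbTE (condF x)) in et.
  have := leW x _ (leqnn _); have := bT (iter (k x) step (init x)) Logic.I.
  by rewrite !natrDE; lia.
exists t => //; apply: leq_trans le_t _.
by rewrite leq_mul2r addn1 ltnS le_k orbT.
Qed.

Arguments enc {s} _ : simpl never.

(** * Polynomial-time list processing *)

Section EncodingSize.
Variables A B : encType.

Lemma dsize_pair (a : A) (b : B) : dsize (enc (a, b)) = (dsize (enc a) + dsize (enc b)).+1.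
Proof. by []. Qed.

Lemma dsize_cons (a : A) (s : seq A) : dsize (enc (a :: s)) = (dsize (enc a) + dsize (enc s)).+1.
Proof. by []. Qed.

Lemma dsize_nat (n : nat) : dsize (enc n) = n.*2.+1.
Proof. by rewrite /enc /=; elim: n => //= n ->. Qed.

Lemma dsize_bool (b : bool) : dsize (enc b) = (b.*2).+1.
Proof. by case: b. Qed.

Lemma dsize_seq (s : seq A) : dsize (enc s) = (sumn [seq dsize (enc a) | a <- s] + size s).+1.
Proof. by elim: s => // a s IH; rewrite dsize_cons IH /=; lia. Qed.

Lemma dsize_mem (a : A) (s : seq A) : a \in s -> dsize (enc a) < dsize (enc s).
Proof.
elim: s => // b s IH; rewrite inE dsize_cons => /predU1P[->|/IH]; last lia.
by rewrite ltnS leq_addr.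
Qed.

Lemma dsize_subseq (s t : seq A) : subseq s t -> dsize (enc s) <= dsize (enc t).
Proof.
elim: t s => [|b t IH] s; first by rewrite subseq0 => /eqP->.
case: s => [_|a s]; first exact: dsize_gt0.
have -> : subseq (a :: s) (b :: t) = subseq (if a == b then s else a :: s) t by [].
by case: eqP => [->|_] /IH; rewrite !dsize_cons; lia.
Qed.

Lemma dsize_drop (j : nat) (s : seq A) : dsize (enc (drop j s)) <= dsize (enc s).
Proof. exact: dsize_subseq (drop_subseq s j). Qed.

Lemma size_dsize (s : seq A) : size s < dsize (enc s).
Proof. by rewrite dsize_seq ltnS leq_addl. Qed.

Lemma dsize_seq_le (s : seq A) (k : nat) :
  (forall a, a \in s -> dsize (enc a) <= k) -> dsize (enc s) <= (size s * k.+1).+1.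
Proof.
elim: s => // a s IH le_k; rewrite dsize_cons /= ltnS mulSn.
have := le_k a (mem_head _ _); have := IH (fun b sb => le_k b (@mem_behead _ (a :: s) b sb)).
by lia.
Qed.

End EncodingSize.

(** The fold becomes a loop on triples of the input, the accumulator and the rest of the list; the
    input is carried along because [g] depends on it. *)
Lemma ptime_foldl_prefix (A B C : encType) (l : A -> seq B) (i : A -> C)
    (g : A -> C -> B -> C) :
  ptime l -> ptime i -> ptime (fun z : A * C * B => g z.1.1 z.1.2 z.2) ->
  (exists c : {poly nat}, forall x j,
     dsize (enc (foldl (g x) (i x) (take j (l x)))) <= (c.[dsize (enc x)])%R) ->
  ptime (fun x => foldl (g x) (i x) (l x)).
Proof.
move=> pl pi pg [c cP]; have [d dP] := ptime_bounded pl.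
pose step (s : A * C * seq B) :=
  if s.2 is a :: l' then (s.1.1, g s.1.1 s.1.2 a, l') else s.
have iter_step x j : j <= size (l x) ->
    iter j step (x, i x, l x) = (x, foldl (g x) (i x) (take j (l x)), drop j (l x)).
  elim: j => [|j IH] lt_j; first by rewrite take0 drop0.
  rewrite iterS IH 1?ltnW //; case El: (l x) lt_j => [//|b0 l'] lt_j.
  rewrite -{}El in lt_j *.
  rewrite (drop_nth b0) // /step /= (take_nth b0) //.
  by rewrite -cats1 foldl_cat.
have pstep : ptime step.
  apply: ptime_case_seq; first exact: ptime_snd (ptime_id _).
    exact: ptime_id.
  have p1 : ptime (fun z : A * C * seq B * (B * seq B) => z.1.1) by
    exact: ptime_fst (ptime_fst (ptime_id _)).
  have p2 : ptime (fun z : A * C * seq B * (B * seq B) => z.2.1) by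
    exact: ptime_fst (ptime_snd (ptime_id _)).
  apply: ptime_pair; last exact: ptime_snd (ptime_snd (ptime_id _)).
  apply: ptime_pair; first exact: ptime_fst p1.
  exact: (ptime_comp pg (ptime_pair p1 p2)).
pose cond (s : A * C * seq B) := if s.2 is _ :: _ then true else false.
have pcond : ptime cond.
  apply: ptime_case_seq; [exact: ptime_snd (ptime_id _) | exact: ptime_const..].
have pinit : ptime (fun x => (x, i x, l x)).
  by do 2!apply: ptime_pair => //; exact: ptime_id.
(* The summands bound the three components of the state, and 2 pays for the two pairings; [d] also
   bounds the number of rounds. *)
have H := @ptime_while _ _ _ _ _ (fun x => size (l x)) ('X + c + d + 2%N%:P)%R pinit pcond pstep.
have {}H : ptime (fun x => iter (size (l x)) step (x, i x, l x)).
  apply: H => [x|x j le_j|x j lt_j|x].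
  - rewrite !horner_natD hornerX horner_natC.
    have := dP x Logic.I; have := size_dsize (l x); lia.
  - rewrite iter_step // !horner_natD hornerX horner_natC !dsize_pair.
    have := dP x Logic.I; have := cP x j.
    have := dsize_drop j (l x); lia.
  - rewrite iter_step 1?ltnW // /cond /=.
    by case: drop (size_drop j (l x)) => [|//] /esym/eqP; rewrite subn_eq0 leqNgt lt_j.
  - by rewrite iter_step // /cond drop_size.
apply: eq_ptime (ptime_snd (ptime_fst H)) => x.
by rewrite iter_step // take_size.
Qed.

(** If each entry adds at most an amount that depends on [x] alone, accumulators stay polynomial;
    growth by a constant factor would already be exponential. *)
Lemma ptime_foldl (A B C : encType) (l : A -> seq B) (i : A -> C)
    (g : A -> C -> B -> C) :
  ptime l -> ptime i -> ptime (fun z : A * C * B => g z.1.1 z.1.2 z.2) ->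
  (exists c : {poly nat}, forall x acc a, a \in l x ->
     dsize (enc (g x acc a)) <= dsize (enc acc) + (c.[dsize (enc x)])%R) ->
  ptime (fun x => foldl (g x) (i x) (l x)).
Proof.
move=> pl pi pg [c cP]; apply: ptime_foldl_prefix => //.
have [d dP] := ptime_bounded pl; have [e eP] := ptime_bounded pi.
exists (e + d * c)%R => x j; rewrite horner_natD horner_natM.
have /= := dP x Logic.I; have /= := eP x Logic.I.
move: (dsize (enc x)) (cP x) => n {}cP le_e le_d.
apply: (@leq_trans (e.[n]%R + size (take j (l x)) * c.[n]%R)); last first.
  rewrite leq_add2l leq_mul2r; apply/orP; right; apply: leq_trans le_d.
  by apply: leq_trans (ltnW (size_dsize _)); rewrite size_take_min geq_minr.
have: {subset take j (l x) <= l x} by move=> a; apply: mem_take.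
elim/last_ind: (take j (l x)) => [|s a IH] sub_s; first by rewrite mul0n addn0.
rewrite -cats1 foldl_cat /= cats1 size_rcons mulSn.
have := cP (foldl (g x) (i x) s) a (sub_s _ _); rewrite mem_rcons mem_head => /(_ isT).
have /IH: {subset s <= l x} by move=> b sb; rewrite sub_s // mem_rcons inE sb orbT.
by lia.
Qed.

Lemma ptime_negb (A : encType) (b : A -> bool) : ptime b -> ptime (fun x => ~~ b x).
Proof. by move=> pb; apply: ptime_if pb (ptime_const _ _) (ptime_const _ _). Qed.

Lemma ptime_andb (A : encType) (b c : A -> bool) :
  ptime b -> ptime c -> ptime (fun x => b x && c x).
Proof. by move=> pb pc; apply: ptime_if pb pc (ptime_const _ _). Qed.

Lemma ptime_orb (A : encType) (b c : A -> bool) :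
  ptime b -> ptime c -> ptime (fun x => b x || c x).
Proof. by move=> pb pc; apply: ptime_if pb (ptime_const _ _) pc. Qed.

(** The tactic [pt] built from these pieces proves [ptime] goals by following the syntax of the
    function body. *)
Ltac pt_hyp := match goal with
  | H : @ptime _ _ ?f |- @ptime _ _ ?g => unify f g; exact H
  | H : @ptime _ _ ?f |- @ptime _ _ (fun x => ?f (@?g x)) => refine (ptime_comp H _)
  | H : @ptime _ _ (fun z => ?f z.1 z.2) |- @ptime _ _ (fun x => ?f (@?g x) (@?h x)) =>
      refine (ptime_comp2 H _ _)
  | H : @ptime _ _ (fun z => ?f z.1.1 z.1.2 z.2)
      |- @ptime _ _ (fun x => ?f (@?g x) (@?h x) (@?k x)) =>
      refine (ptime_comp3 H _ _ _)
  end.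

Ltac pt_core := first
  [ exact (ptime_id _) | exact (ptime_const _ _) | pt_hyp
  | match goal with
    | |- @ptime _ _ fst => exact (ptime_fst (ptime_id _))
    | |- @ptime _ _ snd => exact (ptime_snd (ptime_id _))
    | |- @ptime _ _ (fun x => fst _) => refine (ptime_fst _)
    | |- @ptime _ _ (fun x => snd _) => refine (ptime_snd _)
    | |- @ptime _ _ (fun x => (_, _)) => refine (ptime_pair _ _)
    end
  | refine (ptime_cons _ _) | refine (ptime_DCons _ _) | refine (ptime_Some _)
  | refine (ptime_succn _)
  | refine (ptime_eq _ _) | refine (ptime_negb _) | refine (ptime_andb _ _)
  | refine (ptime_orb _ _)
  | refine (ptime_if _ _ _) | refine (ptime_case_seq _ _ _)
  | refine (ptime_case_option _ _ _) | refine (ptime_case_data _ _ _)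
  | refine (ptime_case_nat _ _ _)
  | match goal with |- @ptime _ _ (fun x => enc _) => refine (ptime_enc _) end ].

(* To be extended as more operations are shown to be polynomial-time. *)
Ltac pt_lists := fail.
Ltac pt_user := fail.

Ltac pt := repeat (cbv beta zeta; first [pt_hyp | pt_user | pt_lists | pt_core]).

Section Lists.
Variables A B : encType.

Lemma ptime_rev (f : A -> seq B) : ptime f -> ptime (fun x => rev (f x)).
Proof.
move=> pf; have H : ptime (fun x => foldl (fun acc a => a :: acc) [::] (f x)).
  apply: (@ptime_foldl A B _ f (fun=> [::]) (fun _ acc a => a :: acc)) => //.
  - by pt.
  - by pt.
  have [d dP] := ptime_bounded pf; exists (d + 1%N%:P)%R => x acc a fa.
  rewrite horner_natD horner_natC dsize_cons.
  have := dP x Logic.I; have := dsize_mem fa; lia.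
apply: eq_ptime H => x; rewrite /rev.
by elim: (f x) [::] => //= a s IH acc; rewrite IH.
Qed.

End Lists.

Section ListIterators.
Variables A B C : encType.

Lemma elem_bounded (l : A -> seq B) (g : A -> B -> C) :
  ptime l -> ptime (fun z => g z.1 z.2) ->
  exists c : {poly nat}, forall x a, a \in l x ->
    dsize (enc (g x a)) <= (c.[dsize (enc x)])%R.
Proof.
move=> pl pg; have [d dP] := ptime_bounded pl; have [e eP] := ptime_bounded pg.
exists (e \Po ('X + d))%R => x a la; rewrite horner_nat_comp horner_natD hornerX.
apply: leq_trans (eP (x, a) Logic.I) _; apply: horner_nat_mono.
rewrite dsize_pair; have := dP x Logic.I; have := dsize_mem la; lia.
Qed.

Lemma ptime_map (l : A -> seq B) (g : A -> B -> C) :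
  ptime (fun z => g z.1 z.2) -> ptime l -> ptime (fun x => [seq g x a | a <- l x]).
Proof.
move=> pg pl; have H : ptime (fun x => foldl (fun acc a => g x a :: acc) [::] (l x)).
  apply: (@ptime_foldl A B _ l (fun=> [::]) (fun x acc a => g x a :: acc)) => //.
  - by pt.
  - by pt.
  have [d dP] := elem_bounded pl pg; exists (d + 1%N%:P)%R => x acc a fa.
  rewrite horner_natD horner_natC dsize_cons.
  by have := dP x _ fa; lia.
apply: eq_ptime (ptime_rev H) => x.
rewrite -[RHS]revK; congr rev; rewrite /rev.
by elim: (l x) [::] => //= a s IH acc; rewrite IH.
Qed.

Lemma ptime_filter (l : A -> seq B) (b : A -> B -> bool) :
  ptime (fun z => b z.1 z.2) -> ptime l -> ptime (fun x => [seq a <- l x | b x a]).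
Proof.
move=> pb pl.
have H : ptime (fun x => foldl (fun acc a => if b x a then a :: acc else acc) [::] (l x)).
  apply: (@ptime_foldl A B _ l (fun=> [::])
           (fun x acc a => if b x a then a :: acc else acc)) => //.
  - by pt.
  - by pt.
  have [d dP] := ptime_bounded pl; exists (d + 1%N%:P)%R => x acc a fa.
  rewrite horner_natD horner_natC; have := dP x Logic.I; have := dsize_mem fa.
  by case: (b x a); rewrite ?dsize_cons; lia.
apply: eq_ptime (ptime_rev H) => x.
rewrite -[RHS]revK; congr rev; rewrite /rev.
by elim: (l x) [::] => //= a s IH acc; rewrite IH; case: (b x a).
Qed.

Lemma ptime_all (l : A -> seq B) (b : A -> B -> bool) :
  ptime (fun z => b z.1 z.2) -> ptime l -> ptime (fun x => all (b x) (l x)).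
Proof.
move=> pb pl.
have H : ptime (fun x => foldl (fun acc a => acc && b x a) true (l x)).
  apply: (@ptime_foldl A B _ l (fun=> true) (fun x acc a => acc && b x a)) => //.
  - by pt.
  - by pt.
  exists (3%N%:P)%R => x acc a _; rewrite horner_natC !dsize_bool.
  by case: acc; case: (b x a).
apply: eq_ptime H => x; rewrite -[RHS]/(true && _).
elim: (l x) true => [|a s IH] acc /=; first by rewrite andbT.
by rewrite IH andbA.
Qed.

Lemma ptime_size (l : A -> seq B) : ptime l -> ptime (fun x => size (l x)).
Proof.
move=> pl; have H : ptime (fun x => foldl (fun n a => n.+1) 0 (l x)).
  apply: (@ptime_foldl A B _ l (fun=> 0) (fun x n a => n.+1)) => //.
  - by pt.
  - by pt.
  by exists (2%N%:P)%R => x n a _; rewrite horner_natC !dsize_nat; lia.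
apply: eq_ptime H => x; rewrite -[RHS]addn0.
by elim: (l x) 0 => //= a s IH n; rewrite IH addnS.
Qed.

Lemma ptime_cat (f g : A -> seq B) : ptime f -> ptime g -> ptime (fun x => f x ++ g x).
Proof.
move=> pf pg; have prf := ptime_rev pf.
have H : ptime (fun x => foldl (fun acc a => a :: acc) (g x) (rev (f x))).
  apply: (@ptime_foldl A B _ (fun x => rev (f x)) g (fun _ acc a => a :: acc)) => //.
  - by pt.
  have [d dP] := ptime_bounded prf; exists (d + 1%N%:P)%R => x acc a fa.
  rewrite horner_natD horner_natC dsize_cons.
  by have := dP x Logic.I; have := dsize_mem fa; lia.
apply: eq_ptime H => x; rewrite -[in RHS](revK (f x)).
elim: (rev (f x)) (g x) => //= a s IH t.
by rewrite IH rev_cons cat_rcons.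
Qed.

Lemma ptime_last (f : A -> B) (l : A -> seq B) :
  ptime f -> ptime l -> ptime (fun x => last (f x) (l x)).
Proof.
move=> pf pl; have H : ptime (fun x => foldl (fun acc a => a) (f x) (l x)).
  apply: (@ptime_foldl A B _ l f (fun _ _ a => a)) => //.
  - by pt.
  have [d dP] := ptime_bounded pl; exists d => x acc a fa.
  by have := dP x Logic.I; have := dsize_mem fa; lia.
apply: eq_ptime H => x.
by elim: (l x) (f x) => //= a s IH n; rewrite IH.
Qed.

End ListIterators.

Section Loops.
Variables A C : encType.

Lemma ptime_iter (n : A -> nat) (i : A -> C) (g : A -> C -> C) :
  ptime n -> ptime i -> ptime (fun z : A * C => g z.1 z.2) ->
  (exists c : {poly nat}, forall x j, j <= n x ->
     dsize (enc (iter j (g x) (i x))) <= (c.[dsize (enc x)])%R) ->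
  ptime (fun x => iter (n x) (g x) (i x)).
Proof.
move=> pn pi pg [c cP].
have iterE x j : foldl (fun acc (_ : unit) => g x acc) (i x) (nseq j tt) = iter j (g x) (i x).
  by elim: j (i x) => //= j IH y; rewrite IH -iterSr.
have pn' := ptime_nseq_unit pn.
have H : ptime (fun x => foldl (fun acc (_ : unit) => g x acc) (i x) (nseq (n x) tt)).
  apply: (@ptime_foldl_prefix A _ C _ i (fun x acc _ => g x acc)) => //.
  - by pt.
  have takeE j k : take j (nseq k tt) = nseq (minn j k) tt.
    by elim: j k => [|j IH] [|k] //=; rewrite IH minnSS.
  by exists c => x j; rewrite takeE iterE; apply: cP; exact: geq_minr.
by apply: eq_ptime H => x; apply: iterE.
Qed.

Lemma ptime_iter_add (n : A -> nat) (i : A -> C) (g : A -> C -> C) :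
  ptime n -> ptime i -> ptime (fun z : A * C => g z.1 z.2) ->
  (exists c : {poly nat}, forall x acc,
     dsize (enc (g x acc)) <= dsize (enc acc) + (c.[dsize (enc x)])%R) ->
  ptime (fun x => iter (n x) (g x) (i x)).
Proof.
move=> pn pi pg [c cP]; apply: ptime_iter => //.
have [d dP] := ptime_bounded pi; have [e eP] := ptime_bounded pn.
exists (d + e * c)%R => x j le_j; rewrite horner_natD horner_natM.
have := dP x Logic.I; have := eP x Logic.I; rewrite dsize_nat.
move: (dsize (enc x)) (cP x) => s {}cP le_n le_i.
apply: (@leq_trans (d.[s]%R + j * c.[s]%R)); last first.
  by rewrite leq_add2l leq_mul2r; apply/orP; right; lia.
elim: j {le_j} => [|j IH]; first by rewrite mul0n addn0.
by rewrite iterS mulSn; have := cP (iter j (g x) (i x)); lia.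
Qed.

End Loops.

Section Arithmetic.
Variables A B C : encType.

Lemma ptime_nseq (n : A -> nat) (f : A -> B) :
  ptime n -> ptime f -> ptime (fun x => nseq (n x) (f x)).
Proof.
move=> pn pf; have H : ptime (fun x => iter (n x) (cons (f x)) [::]).
  apply: (@ptime_iter_add A _ n (fun=> [::]) (fun x l => f x :: l)); [pt..|].
  have [d dP] := ptime_bounded pf; exists (d + 1%N%:P)%R => x acc.
  by rewrite dsize_cons horner_natD horner_natC; have := dP x Logic.I; lia.
apply: eq_ptime H => x; rewrite /nseq /ncons.
by [].
Qed.

Lemma ptime_addn (f g : A -> nat) : ptime f -> ptime g -> ptime (fun x => f x + g x).
Proof.
move=> pf pg; have H : ptime (fun x => iter (f x) succn (g x)).
  apply: (@ptime_iter_add A _ f g (fun _ => succn)); [pt..|].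
  by exists (2%N%:P)%R => x n; rewrite horner_natC !dsize_nat; lia.
by apply: eq_ptime H => x; rewrite iter_succn addnC.
Qed.

Lemma ptime_subn (f g : A -> nat) : ptime f -> ptime g -> ptime (fun x => f x - g x).
Proof.
move=> pf pg; have H : ptime (fun x => iter (g x) predn (f x)).
  apply: (@ptime_iter_add A _ g f (fun _ => predn)); [pt..| |].
    apply: (@eq_ptime _ _ (fun z => if z.2 is k.+1 then k else 0)); last by pt.
    by case=> ? [].
  by exists (0%:P)%R => x n; rewrite horner_natC !dsize_nat; lia.
by apply: eq_ptime H => x; rewrite iter_predn.
Qed.

Lemma ptime_leq (f g : A -> nat) : ptime f -> ptime g -> ptime (fun x => f x <= g x).
Proof. by move=> pf pg; apply: ptime_eq (ptime_subn pf pg) (ptime_const _ _). Qed.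

Lemma ptime_drop (n : A -> nat) (l : A -> seq B) :
  ptime n -> ptime l -> ptime (fun x => drop (n x) (l x)).
Proof.
move=> pn pl; have H : ptime (fun x => iter (n x) behead (l x)).
  apply: (@ptime_iter_add A _ n l (fun _ => behead)); [pt..| |].
    apply: (@eq_ptime _ _ (fun z => if z.2 is _ :: s then s else [::])); last by pt.
    by case=> ? [].
  exists (0%:P)%R => x n'; rewrite horner_natC addn0.
  by rewrite -drop1 dsize_drop.
apply: eq_ptime H => x.
by elim: (n x) => [|k IH]; rewrite ?drop0 // iterS IH -drop1 drop_drop.
Qed.

Lemma ptime_nth (d : A -> B) (l : A -> seq B) (n : A -> nat) :
  ptime d -> ptime l -> ptime n -> ptime (fun x => nth (d x) (l x) (n x)).
Proof.
move=> pd pl pn; have pdrop := ptime_drop pn pl.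
apply: (@eq_ptime _ _ (fun x => if drop (n x) (l x) is b :: _ then b else d x)).
  by move=> x; rewrite -[n x in RHS]addn0 -nth_drop; case: drop.
by refine (ptime_case_seq pdrop pd _); pt.
Qed.

Lemma ptime_odd (n : A -> nat) : ptime n -> ptime (fun x => odd (n x)).
Proof.
move=> pn; have H : ptime (fun x => iter (n x) negb false).
  apply: (@ptime_iter_add A _ n (fun=> false) (fun _ => negb)); [pt..|].
  by exists (3%N%:P)%R => x b; rewrite horner_natC !dsize_bool; case: b.
by apply: eq_ptime H => x; elim: (n x) => //= k ->.
Qed.

(** The entry added in a round is the current length, so its size is not controlled by the input for
    arbitrary accumulators; the lists actually reached are bounded instead. *)
Lemma ptime_iota (n : A -> nat) : ptime n -> ptime (fun x => iota 0 (n x)).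
Proof.
move=> pn; have H : ptime (fun x => iter (n x) (fun l : seq nat => size l :: l) [::]).
  apply: (@ptime_iter A _ n (fun=> [::] : seq nat) (fun _ l => size l :: l)) => //.
  - by pt.
  - by pt; apply: ptime_size; pt.
  have [d dP] := ptime_bounded pn.
  exists (d * (d + 1%N%:P) + 1%N%:P)%R => x j le_j.
  have szE k : size (iter k (fun l : seq nat => size l :: l) [::]) = k.
    by elim: k => //= k ->.
  rewrite horner_natD horner_natM horner_natD !horner_natC.
  have := dP x Logic.I; rewrite dsize_nat.
  move: (d.[_])%R => M le_M.
  apply: leq_trans (dsize_seq_le (k := M) _) _.
    move=> a; have: all (ltn^~ j) (iter j (fun l : seq nat => size l :: l) [::]).
      elim: (j) => //= k IH; rewrite szE ltnSn /=.
      by apply: sub_all IH => i /= lt_i; apply: ltnW.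
    by move=> /allP H /H /=; rewrite dsize_nat; lia.
  by rewrite szE !addn1 ltnS leq_mul //; lia.
apply: eq_ptime (ptime_rev H) => x.
elim: (n x) => // k IH; rewrite -addn1 iotaD add0n cats1 -IH addn1 iterS rev_cons.
by congr rcons; elim: (k) => //= i ->.
Qed.

End Arithmetic.

Section MoreLists.
Variables A B C : encType.

Lemma ptime_sumn (l : A -> seq nat) : ptime l -> ptime (fun x => sumn (l x)).
Proof.
move=> pl; have H : ptime (fun x => foldl addn 0 (l x)).
  apply: (@ptime_foldl A _ _ l (fun=> 0) (fun _ => addn)) => //; first by pt.
    by refine (ptime_addn _ _); pt.
  have [d dP] := ptime_bounded pl; exists d => x acc a fa.
  by have := dP x Logic.I; have := dsize_mem fa; rewrite !dsize_nat; lia.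
apply: eq_ptime H => x; rewrite -[RHS]add0n.
elim: (l x) 0 => [|a s IH] n /=; first by rewrite addn0.
by rewrite IH addnA.
Qed.

Lemma ptime_mem (a : A -> B) (l : A -> seq B) :
  ptime a -> ptime l -> ptime (fun x => a x \in l x).
Proof.
move=> pa pl.
have : ptime (fun x => ~~ all (fun b => b != a x) (l x)).
  by apply: ptime_negb; apply: (ptime_all (b := fun x b => b != a x)) => //; pt.
apply: eq_ptime => x.
rewrite -has_predC; apply/hasP/idP => [[b lb /=]|la].
  by rewrite negbK => /eqP <-.
by exists (a x) => //=; rewrite negbK.
Qed.

Lemma ptime_index (a : A -> B) (l : A -> seq B) :
  ptime a -> ptime l -> ptime (fun x => index (a x) (l x)).
Proof.
move=> pa pl.
pose g x (acc : bool * nat) (b : B) :=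
  if acc.1 then acc else if b == a x then (true, acc.2) else (false, acc.2.+1).
have H : ptime (fun x => foldl (g x) (false, 0) (l x)).
  apply: (@ptime_foldl A B _ l (fun=> (false, 0)) g) => //.
  - by pt.
  - by rewrite /g; pt.
  have gE x b n c : g x (b, n) c =
      (b || (c == a x), if b || (c == a x) then n else n.+1).
    by rewrite /g; case: b => //=; case: eqP.
  exists (4%N%:P)%R => x [b n] c _; rewrite horner_natC gE !dsize_pair !dsize_bool !dsize_nat.
  by case: (b); case: (c == a x); rewrite /=; lia.
apply: eq_ptime (ptime_snd H) => x; rewrite -[RHS]addn0.
have gT n s : foldl (g x) (true, n) s = (true, n) by elim: s.
elim: (l x) 0 => //= b s IH n; rewrite /g /=.
by case: eqP => _; rewrite ?gT //= IH addnS.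
Qed.

Lemma ptime_zip (s : A -> seq B) (t : A -> seq C) :
  ptime s -> ptime t -> ptime (fun x => zip (s x) (t x)).
Proof.
move=> ps ptt.
pose g (acc : seq C * seq (B * C)) (b : B) :=
  if acc.1 is c :: t' then (t', (b, c) :: acc.2) else acc.
have H : ptime (fun x => foldl g (t x, [::]) (s x)).
  apply: (@ptime_foldl A B _ s (fun x => (t x, [::])) (fun=> g)) => //.
  - by pt.
  - by rewrite /g; pt.
  have [d dP] := ptime_bounded ps; exists (d + 2%N%:P)%R => x [[|c t'] r] a fa.
    by rewrite leq_addr.
  rewrite -[g _ _]/(t', (a, c) :: r) horner_natD horner_natC !dsize_pair !dsize_cons dsize_pair.
  by have := dP x Logic.I; have := dsize_mem fa; lia.
apply: eq_ptime (ptime_rev (ptime_snd H)) => x.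
rewrite -[RHS]revK; congr rev; rewrite /rev.
elim: (s x) (t x) [::] => [|b s' IH] [|c t'] r //=.
  by elim: s' {IH}.
exact: IH.
Qed.

End MoreLists.

(** * Pairings of lists and of products of lists *)

Section Mates.
Variable T : eqType.
Implicit Types (L : seq T) (Ls : seq (seq T)) (a : T) (s : seq T).

(* Consecutive entries are paired; the last one is alone if the length is odd. *)
Definition mate L a : T :=
  let i := index a L in nth a L (if odd i then i.-1 else i.+1).

Lemma mate_in L a : a \in L -> mate L a \in L.
Proof.
move=> La; rewrite /mate /=; case: ifP => _.
  by rewrite mem_nth // (leq_ltn_trans (leq_pred _)) // index_mem.
have [lt_i|le_i] := ltnP (index a L).+1 (size L); first exact: mem_nth.
by rewrite nth_default.
Qed.

Lemma mateK L a : uniq L -> a \in L -> mate L (mate L a) = a.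
Proof.
move=> uL La; have lt_i : index a L < size L by rewrite index_mem.
have Ei : nth a L (index a L) = a by rewrite nth_index.
rewrite /mate /=; move: (index a L) lt_i Ei => i lt_i Ei; case: ifP => odd_i.
  have lt_i' : i.-1 < size L by apply: leq_ltn_trans (leq_pred _) lt_i.
  rewrite index_uniq // (_ : odd i.-1 = false).
    2: by case: i odd_i {lt_i Ei lt_i'} => //= i /negbTE.
  by rewrite prednK ?odd_gt0 // (set_nth_default a).
have [lt_i'|le_i] := ltnP i.+1 (size L).
  by rewrite index_uniq //= odd_i /= (set_nth_default a).
rewrite (nth_default _ le_i) (_ : index a L = i) ?odd_i ?nth_default //.
by rewrite -{1}Ei index_uniq.
Qed.

(** Neighbouring positions of a list without repetitions hold different entries, so only the default
    value [a] of [nth] can return [a]; this happens at an even index that is the last one. *)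
Lemma mate_fix L a : uniq L -> a \in L -> mate L a = a ->
  odd (size L) /\ forall x0, a = last x0 L.
Proof.
move=> uL La; have lt_i : index a L < size L by rewrite index_mem.
have Ei : nth a L (index a L) = a by rewrite nth_index.
rewrite /mate /=; move: (index a L) lt_i Ei => i lt_i Ei; case: ifP => odd_i.
  rewrite -{2}Ei => /eqP; rewrite nth_uniq ?(leq_ltn_trans (leq_pred _)) // => /eqP.
  by case: i odd_i {lt_i Ei} => //= i _ E; have := ltnn i; rewrite {2}E ltnSn.
have [lt_i' /eqP|le_i _] := ltnP i.+1 (size L).
  by rewrite -{2}Ei nth_uniq // => /eqP E; have := ltnn i; rewrite -{2}E ltnSn.
have Es : size L = i.+1 by apply/eqP; rewrite eqn_leq le_i lt_i.
by rewrite Es /= odd_i; split=> // x0; rewrite -nth_last Es /= -{1}Ei (set_nth_default x0).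
Qed.

Lemma mate_last L x0 : uniq L -> odd (size L) -> mate L (last x0 L) = last x0 L.
Proof.
move=> uL oL; have L0 : 0 < size L by rewrite odd_gt0.
rewrite /mate -nth_last index_uniq //; last by rewrite prednK.
have -> : odd (size L).-1 = false by case: (size L) oL => //= n /negbTE.
by rewrite prednK // nth_default // nth_last.
Qed.

Lemma last_in L x0 : odd (size L) -> last x0 L \in L.
Proof. by case: L => //= a L _; exact: mem_last. Qed.

Definition in_product Ls s : bool :=
  (size s == size Ls) && all (fun z => z.2 \in z.1) (zip Ls s).

Fixpoint product_mate (zs : seq (seq T * T)) : seq T :=
  if zs is (L, a) :: zs' then
    if mate L a != a then mate L a :: unzip2 zs' else a :: product_mate zs'
  else [::].

Lemma in_product_cons L Ls a s :
  in_product (L :: Ls) (a :: s) = (a \in L) && in_product Ls s.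
Proof. by rewrite /in_product /= eqSS andbCA. Qed.

Lemma in_product_size Ls s : in_product Ls s -> size s = size Ls.
Proof. by case/andP => /eqP. Qed.

Lemma product_mate_cons L Ls a s : in_product Ls s ->
  product_mate (zip (L :: Ls) (a :: s)) =
  if mate L a != a then mate L a :: s else a :: product_mate (zip Ls s).
Proof. by move=> /in_product_size szs /=; rewrite unzip2_zip // szs. Qed.

Lemma product_mate_in Ls s :
  in_product Ls s -> in_product Ls (product_mate (zip Ls s)).
Proof.
elim: Ls s => [|L Ls IH] [|a s] //; rewrite in_product_cons => /andP[La Ps].
rewrite product_mate_cons //; case: ifP => _; rewrite in_product_cons ?La ?IH //.
by rewrite mate_in.
Qed.

(** The moved coordinate is still movable after the move, and the earlier ones are still left alone,
    so the second application finds the same coordinate and moves it back. *)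
Lemma product_mateK Ls s : all uniq Ls -> in_product Ls s ->
  product_mate (zip Ls (product_mate (zip Ls s))) = s.
Proof.
elim: Ls s => [|L Ls IH] [|a s] // /andP[uL uLs].
rewrite in_product_cons => /andP[La Ps].
rewrite product_mate_cons //; case: ifP => ne_a.
  by rewrite product_mate_cons // mateK // eq_sym ne_a.
by rewrite product_mate_cons ?product_mate_in // ne_a IH.
Qed.

Lemma product_mate_fix Ls s x0 : all uniq Ls -> in_product Ls s ->
  product_mate (zip Ls s) = s ->
  all (fun L => odd (size L)) Ls /\ s = [seq last x0 L | L <- Ls].
Proof.
elim: Ls s => [|L Ls IH] [|a s] // /andP[uL uLs].
rewrite in_product_cons => /andP[La Ps].
rewrite product_mate_cons //; case: eqP => [Ea|ne_a] /= [] // /(IH _ uLs Ps)[-> {1}->].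
by have [-> /(_ x0)->] := mate_fix uL La Ea.
Qed.

Lemma product_mate_last Ls x0 : all uniq Ls -> all (fun L => odd (size L)) Ls ->
  product_mate (zip Ls [seq last x0 L | L <- Ls]) = [seq last x0 L | L <- Ls].
Proof.
elim: Ls => //= L Ls IH /andP[uL uLs] /andP[oL oLs].
by rewrite mate_last // eqxx /= IH.
Qed.

Lemma in_product_last Ls x0 : all (fun L => odd (size L)) Ls ->
  in_product Ls [seq last x0 L | L <- Ls].
Proof.
elim: Ls => // L Ls IH /= /andP[oL oLs].
by rewrite in_product_cons last_in // IH.
Qed.

Lemma in_product_nth Ls s x0 : in_product Ls s <->
  size s = size Ls /\ forall i, i < size Ls -> nth x0 s i \in nth [::] Ls i.
Proof.
rewrite /in_product; split=> [/andP[/eqP szs /allP H]|[szs H]].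
  split=> // i lt_i; have := H (nth ([::], x0) (zip Ls s) i).
  by rewrite nth_zip //=; apply; rewrite -nth_zip // mem_nth // size_zip szs minnn.
rewrite szs eqxx; apply/(all_nthP ([::], x0)) => i.
by rewrite size_zip szs minnn => lt_i; rewrite nth_zip //= H.
Qed.

End Mates.

(** * Terms and points of an instance *)

(* The number of variables, the blocks, the encoded pairing program and the
   exceptional occurrence. *)
Definition instance : Type := (nat * (seq (seq (seq (seq nat))) * (data * term)))%type.

Implicit Types (X : instance) (s : seq bool) (t : term).

Definition block X (i : nat) : seq (seq (seq nat)) := nth [::] X.2.1 i.

Definition nonvanishing (u : seq nat) s : bool :=
  all (fun z => (z.1 == 0) || z.2) (zip u s).

(** The value of the factor [p] at [s] is the parity of the length of this list. This is how values
    of the polynomial become parities of degrees. *)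
Definition live (p : seq (seq nat)) s : seq nat :=
  [seq a <- iota 0 (size p) | nonvanishing (nth [::] p a) s].

Definition choices (b : seq (seq (seq nat))) s : seq (seq nat) :=
  [seq live p s | p <- b].

Definition incident X s t : bool :=
  [&& size s == X.1, t.1 < size X.2.1 & in_product (choices (block X t.1) s) t.2].

Definition is_termb X t : bool :=
  (t.1 < size X.2.1) &&
  in_product [seq iota 0 (size p) | p <- block X t.1] t.2.

Definition exponents X t : seq nat :=
  [seq sumn [seq nth 0 (nth [::] z.1 z.2) i | z <- zip (block X t.1) t.2]
     | i <- iota 0 X.1].

Definition coords (e : seq nat) : seq (seq bool) :=
  [seq (if n == 0 then [:: false; true] else [:: true]) | n <- e].

(** The terms left alone within their own blocks, at most one per block. A block contributes one
    exactly when all its factors, hence their product, have value 1 at [s]. *)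
Definition fixed_terms X s : seq term :=
  [seq (i, [seq last 0 L | L <- choices (block X i) s])
     | i <- [seq i <- iota 0 (size X.2.1)
               | all (fun L => odd (size L)) (choices (block X i) s)]].

Definition point_mate X s t : term :=
  let a := product_mate (zip (choices (block X t.1) s) t.2) in
  if a != t.2 then (t.1, a) else mate (fixed_terms X s) t.

Lemma live_uniq p s : uniq (live p s).
Proof. exact: filter_uniq (iota_uniq _ _). Qed.

Lemma choices_uniq b s : all uniq (choices b s).
Proof. by apply/allP => L /mapP[p _ ->]; exact: live_uniq. Qed.

Lemma fixed_terms_uniq X s : uniq (fixed_terms X s).
Proof. by rewrite map_inj_uniq ?filter_uniq ?iota_uniq // => i j []. Qed.

Lemma fixed_terms_mem X s t : size s = X.1 ->
  t \in fixed_terms X s ->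
  incident X s t /\ product_mate (zip (choices (block X t.1) s) t.2) = t.2.
Proof.
move=> szs /mapP[i]; rewrite mem_filter mem_iota => /andP[oddi /= lt_i] ->.
rewrite /incident szs eqxx lt_i /= in_product_last //.
by rewrite product_mate_last ?choices_uniq.
Qed.

Lemma incident_fixed X s t : incident X s t ->
  product_mate (zip (choices (block X t.1) s) t.2) = t.2 -> t \in fixed_terms X s.
Proof.
case/and3P => _ lt_t Pt Et.
have [oddt Et2] := product_mate_fix 0 (choices_uniq _ _) Pt Et.
apply/mapP; exists t.1; first by rewrite mem_filter oddt mem_iota.
by rewrite -Et2 -surjective_pairing.
Qed.

Lemma point_mate_incident X s t : incident X s t -> incident X s (point_mate X s t).
Proof.
move=> inc; have /and3P[/eqP szs lt_t Pt] := inc; rewrite /point_mate /=.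
case: eqP => [/(incident_fixed inc) fix_t|_] /=.
  by have [] := fixed_terms_mem szs (mate_in fix_t).
by rewrite /incident szs eqxx lt_t product_mate_in.
Qed.

(** The two cases of [point_mate] do not mix: a tuple that moves is moved back in its block, and the
    mate of a term left alone is again one left alone. *)
Lemma point_mateK X s t : incident X s t -> point_mate X s (point_mate X s t) = t.
Proof.
move=> inc; have /and3P[/eqP szs lt_t Pt] := inc; rewrite {2}/point_mate /=.
case: eqP => [/(incident_fixed inc) fix_t|/eqP ne_t] /=.
  have [_ E] := fixed_terms_mem szs (mate_in fix_t).
  by rewrite /point_mate E eqxx /= mateK // fixed_terms_uniq.
rewrite /point_mate /= product_mateK ?choices_uniq // eq_sym ne_t.
by rewrite -surjective_pairing.
Qed.

Lemma point_mate_fix X s t : incident X s t -> point_mate X s t = t ->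
  odd (size (fixed_terms X s)) /\ t = last (0, [::]) (fixed_terms X s).
Proof.
move=> inc; rewrite /point_mate /=.
case: eqP => [/(incident_fixed inc) fix_t|/eqP ne_t] /= Et.
  by have [odd_F lastE] := mate_fix (fixed_terms_uniq _ _) fix_t Et; split; last exact: lastE.
by have /= E := congr1 snd Et; rewrite E eqxx in ne_t.
Qed.

Definition well_formed X : Prop :=
  forall b p u, b \in X.2.1 -> p \in b -> u \in p -> size u = X.1.

Lemma sumn_eq0 (l : seq nat) : (sumn l == 0) = all (eq_op^~ 0) l.
Proof. by elim: l => //= n l <-; rewrite addn_eq0. Qed.

Lemma size_exponents X t : size (exponents X t) = X.1.
Proof. by rewrite size_map size_iota. Qed.

Lemma nth_exponents X t i : i < X.1 -> nth 0 (exponents X t) i =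
  sumn [seq nth 0 (nth [::] z.1 z.2) i | z <- zip (block X t.1) t.2].
Proof. by move=> lt_i; rewrite (nth_map 0) ?size_iota // nth_iota. Qed.

Lemma is_term_nth X t : is_termb X t <->
  [/\ t.1 < size X.2.1, size t.2 = size (block X t.1)
    & forall j, j < size (block X t.1) ->
        nth 0 t.2 j < size (nth [::] (block X t.1) j)].
Proof.
rewrite /is_termb; split.
  case/andP => lt_t /in_product_nth => /(_ 0); rewrite size_map => -[szt H].
  split=> // j lt_j; have := H j lt_j.
  by rewrite (nth_map [::]) // mem_iota.
case=> lt_t szt H; rewrite lt_t /=; apply/(in_product_nth _ _ 0).
rewrite size_map; split=> // j lt_j.
by rewrite (nth_map [::]) // mem_iota; apply: H.
Qed.

Lemma incident_is_term X s t : incident X s t -> is_termb X t.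
Proof.
case/and3P => _ lt_t /in_product_nth => /(_ 0); rewrite size_map => -[szt H].
apply/is_term_nth; split=> // j lt_j; have := H j lt_j.
by rewrite (nth_map [::]) // mem_filter mem_iota => /and3P[].
Qed.

Lemma in_coords e s : in_product (coords e) s <->
  size s = size e /\ forall i, i < size e -> (nth 0 e i == 0) || nth false s i.
Proof.
split=> [/(in_product_nth _ _ false)|] [szs H].
  rewrite size_map in szs H; split=> // i lt_i; have := H i lt_i.
  by rewrite (nth_map 0) //; case: eqP => //= _; rewrite inE => /eqP->.
apply/(in_product_nth _ _ false); rewrite size_map; split=> // i lt_i.
have := H i lt_i; rewrite (nth_map 0) //.
by case: eqP => _ /=; case: (nth false s i).
Qed.

Lemma nonvanishingP u s : size u = size s ->
  reflect (forall i, i < size s -> (nth 0 u i == 0) || nth false s i)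
    (nonvanishing u s).
Proof.
move=> szu; apply: (iffP (all_nthP (0, false))); rewrite size_zip szu minnn => H i lt_i;
  by have := H i lt_i; rewrite nth_zip.
Qed.

(* A term does not vanish at a point iff the point is 1 on its support. *)
Lemma incident_coords X s t : well_formed X -> is_termb X t ->
  incident X s t = in_product (coords (exponents X t)) s.
Proof.
move=> wfX term_t; have [lt_t szt lt_a] := (is_term_nth _ _).1 term_t.
have [szs|nszs] := eqVneq (size s) X.1; last first.
  rewrite /incident (negbTE nszs); apply/esym/negP => /in_coords[szs _].
  by rewrite szs size_exponents eqxx in nszs.
pose mono j := nth [::] (nth [::] (block X t.1) j) (nth 0 t.2 j).
have sz_mono j : j < size (block X t.1) -> size (mono j) = size s.
  move=> lt_j; rewrite szs; apply: (wfX (block X t.1) (nth [::] (block X t.1) j)).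
  - exact: mem_nth.
  - exact: mem_nth.
  - exact/mem_nth/lt_a.
have -> : incident X s t = in_product (choices (block X t.1) s) t.2.
  by rewrite /incident szs eqxx lt_t.
(* Exponents add up without cancellation, so a variable is missing from the term iff it is missing
   from each chosen monomial. *)
have expE i : i < X.1 -> (nth 0 (exponents X t) i == 0) <->
    forall j, j < size (block X t.1) -> nth 0 (mono j) i == 0.
  move=> lt_i; rewrite nth_exponents // sumn_eq0 all_map.
  split=> [/allP H j lt_j|H].
    have := H (nth ([::], 0) (zip (block X t.1) t.2) j).
    rewrite mem_nth ?size_zip ?szt ?minnn // => /(_ isT) /=.
    by rewrite nth_zip.
  apply/(all_nthP ([::], 0)) => j; rewrite size_zip szt minnn => lt_j /=.
  by rewrite nth_zip //=; apply: H.
apply/idP/idP.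
  move=> /(in_product_nth _ _ 0)[_]; rewrite size_map => H.
  apply/in_coords; rewrite size_exponents; split=> // i lt_i.
  have [//|/= nz_s] := boolP (nth false s i); rewrite ?orbT // orbF.
  apply/expE => // j lt_j; have := H j lt_j; rewrite (nth_map [::]) //.
  rewrite mem_filter => /andP[/(nonvanishingP (sz_mono j lt_j))/(_ i)].
  by rewrite szs (negbTE nz_s) orbF => /(_ lt_i).
move=> /in_coords[_]; rewrite size_exponents => H.
apply/(in_product_nth _ _ 0); rewrite size_map; split=> // j lt_j.
rewrite (nth_map [::]) // mem_filter mem_iota lt_a // !andbT.
apply/(nonvanishingP (sz_mono j lt_j)) => i; rewrite szs => lt_i.
by have /orP[/(expE i lt_i)/(_ j lt_j)|->] := H i lt_i; rewrite ?orbT // /mono => ->.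
Qed.

Lemma coords_uniq e : all uniq (coords e).
Proof. by apply/allP => L /mapP[n _ ->]; case: eqP. Qed.

(** Among the coordinate lists only [[:: true]] has odd length, and it stands for a positive
    exponent. *)
Lemma coords_fix e s : in_product (coords e) s ->
  product_mate (zip (coords e) s) = s ->
  all (leq 1) e /\ s = nseq (size e) true.
Proof.
move=> Ps /(product_mate_fix false (coords_uniq _) Ps)[odd_e ->].
split.
  apply/allP => n en; have /= := allP odd_e _ (map_f (fun n => if n == 0 then _ else _) en).
  by rewrite lt0n; case: eqP.
rewrite /coords -map_comp; elim: (e) => //= n l ->.
by case: eqP.
Qed.

Lemma in_coords_ones e : in_product (coords e) (nseq (size e) true).
Proof.
by apply/in_coords; rewrite size_nseq; split=> // i lt_i; rewrite nth_nseq lt_i orbT.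
Qed.

Lemma coords_full e : all (leq 1) e ->
  product_mate (zip (coords e) (nseq (size e) true)) = nseq (size e) true.
Proof. by elim: e => //= -[//|n] e IH /= /IH ->. Qed.

(** * The graph *)

Variant node := Point of seq bool | Term of term | Leaf of term & term.

Definition node_sum (v : node) : seq bool + (term + term * term) :=
  match v with
  | Point s => inl s
  | Term t => inr (inl t)
  | Leaf t t' => inr (inr (t, t'))
  end.

Definition sum_node (z : seq bool + (term + term * term)) : node :=
  match z with
  | inl s => Point s
  | inr (inl t) => Term t
  | inr (inr z) => Leaf z.1 z.2
  end.

Lemma node_sumK : cancel node_sum sum_node.
Proof. by case. Qed.

HB.instance Definition _ := Equality.copy node (can_type node_sumK).

Definition all_ones X : node := Point (nseq X.1 true).

(* [l] is the vertex to which the pairing joins [t]. *)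
Definition term_edge X t (l : option node) (w : node) : bool :=
  if w is Point s then in_product (coords (exponents X t)) s else l == Some w.

(** When the product leaves [s] alone, the linked vertex, if any, takes the place of its mate; with
    no link, [odflt] leaves [s] alone. A neighbour that is not a point is that linked vertex and
    goes back to the point of ones. *)
Definition term_mate X t (l : option node) (w : node) : node :=
  if w is Point s then
    let s' := product_mate (zip (coords (exponents X t)) s) in
    if s' != s then Point s' else odflt w l
  else all_ones X.

(** The link is an argument, because finding it requires calls of the given program, which are made
    beforehand. *)
Definition graph_mate X (l : option node) (v w : node) : option node :=
  match v with
  | Point s =>
      if w is Term t then
        if incident X s t then Some (Term (point_mate X s t)) else None
      else None
  | Term t =>
      if is_termb X t && term_edge X t l w then Some (term_mate X t l w) else None
  | Leaf t t' => if (l == Some v) && (w == Term t) then Some w else None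
  end.

Definition is_occurrence X t : bool :=
  is_termb X t && (exponents X t == nseq X.1 1).

Definition linked_term (v : node) : option term :=
  match v with Point _ => None | Term t | Leaf t _ => Some t end.

(** The graph is studied for any partial matching [link] of occurrences in which a failed pair may
    be replaced by a leaf. *)
Section PairedGraph.
Variables (X : instance) (link : term -> option node).
Hypothesis wfX : well_formed X.
Hypothesis link_occ : forall t v, link t = Some v -> is_occurrence X t.
Hypothesis linkP : forall t v, link t = Some v ->
  (exists t', [/\ v = Term t', t' != t & link t' = Some (Term t)]) \/
  (exists t', v = Leaf t t').

Definition phi (v w : node) : option node :=
  graph_mate X (if linked_term v is Some t then link t else None) v w.

Lemma phi_point s w w' : phi (Point s) w = Some w' ->
  exists t, [/\ w = Term t, w' = Term (point_mate X s t) & incident X s t].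
Proof.
by rewrite /phi /=; case: w => // t; case: ifP => // inc [<-]; exists t.
Qed.

Lemma link_not_point t s : link t <> Some (Point s).
Proof. by move=> /linkP[[t' []]|[t']]. Qed.

Lemma occurrence_full t : is_occurrence X t -> all (leq 1) (exponents X t).
Proof. by case/andP => _ /eqP->; rewrite all_nseq orbT. Qed.

Lemma coords_ones_mate t : is_occurrence X t ->
  product_mate (zip (coords (exponents X t)) (nseq X.1 true)) = nseq X.1 true.
Proof. by move=> /occurrence_full /coords_full; rewrite size_exponents. Qed.

Lemma term_mateK t w : is_termb X t -> term_edge X t (link t) w ->
  term_edge X t (link t) (term_mate X t (link t) w) /\
  term_mate X t (link t) (term_mate X t (link t) w) = w.
Proof.
move=> term_t; case: w => [s|t1|t1 t2] /= edge_w.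
- case: eqP => [fix_s|/eqP ne_s] /=; last first.
    by rewrite product_mate_in // product_mateK ?coords_uniq // eq_sym ne_s.
  have [_ ones_s] := coords_fix edge_w fix_s; rewrite size_exponents in ones_s.
  case El: (link t) => [v|] /=; last by rewrite fix_s eqxx.
  have := @link_not_point t; rewrite El.
  by case: v {El} => [s0 /(_ s0)|t1 _|t1 t2 _] //=; rewrite eqxx /all_ones ones_s.
(* A link exists only at an occurrence, all of whose exponents are 1; the point of ones is therefore
   a neighbour that the product leaves alone, and it is sent to the link. *)
- rewrite -{1}(size_exponents X t) in_coords_ones (eqP edge_w) /=.
  by rewrite coords_ones_mate ?eqxx //; apply: link_occ (eqP edge_w).
- rewrite -{1}(size_exponents X t) in_coords_ones (eqP edge_w) /=.
  by rewrite coords_ones_mate ?eqxx //; apply: link_occ (eqP edge_w).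
Qed.

Lemma phi_mateK v w w' : phi v w = Some w' -> phi v w' = Some w.
Proof.
case: v => [s|t|t t'].
- move=> /phi_point[t [-> -> inc]].
  by rewrite /phi /= point_mate_incident // point_mateK.
- rewrite /phi /=; case: ifP => // /andP[term_t edge_w] [<-].
  by have [-> ->] := term_mateK term_t edge_w; rewrite term_t.
- by rewrite /phi /=; case: ifP => // edge_w [<-]; rewrite edge_w.
Qed.

(** A point reads its adjacency to a term from lists of monomials, the term from lists of
    coordinates; [incident_coords] identifies the two. Link edges are symmetric by [linkP]. *)
Lemma phi_sym v w : phi v w -> phi w v.
Proof.
case: v => [s|t|t t'].
- case E: (phi _ _) => [w'|] // _; have [t [-> _ inc]] := phi_point E.
  rewrite /phi /= (incident_is_term inc) /=.
  by rewrite -incident_coords ?inc // (incident_is_term inc).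
- rewrite /phi /=; case: ifP => // /andP[term_t edge_w] _.
  case: w edge_w => [s|t1|t1 t2] /=.
  + by rewrite -incident_coords // => ->.
  + move=> /eqP/[dup]/link_occ occ /linkP[[t' [[->] _ El]]|[t' //]].
    by have /andP[-> _] := link_occ El; rewrite El eqxx.
  + move=> /eqP/[dup] El /linkP[[t' [//]]|[t' [E1 E2]]].
    by rewrite E1 E2 in El *; rewrite El !eqxx.
- rewrite /phi /=; case: ifP => // /andP[/eqP El /eqP->] _ /=.
  by have /andP[-> _] := link_occ El; rewrite El eqxx.
Qed.

Lemma phi_irrefl v : phi v v = None.
Proof.
case: v => [s|t|t t'] //.
- rewrite /phi /=; case: ifP => // /andP[_ /eqP/linkP[[t' [[->]]]|[t' //]]].
  by rewrite eqxx.
- by rewrite /phi /= andbF.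
Qed.

(** Such a term is either an occurrence without link or, having full support without being an
    occurrence, a witness that the degree bound fails. *)
Lemma phi_fix_term t w : phi (Term t) w = Some w ->
  [/\ is_termb X t, link t = None, all (leq 1) (exponents X t) & w = all_ones X].
Proof.
rewrite /phi /=; case: ifP => // /andP[term_t].
case: w => [s|t1|t1 t2] //= edge_w [].
case: eqP => [fix_s|ne_s [/ne_s//]].
have [full ones_s] := coords_fix edge_w fix_s; rewrite size_exponents in ones_s.
case El: (link t) => [v|] /=; last by rewrite /all_ones ones_s.
by move=> Ev; case: (@link_not_point t s); rewrite El Ev.
Qed.

Lemma phi_fix_leaf t t' w : phi (Leaf t t') w = Some w ->
  link t = Some (Leaf t t') /\ w = Term t.
Proof. by rewrite /phi /=; case: ifP => // /andP[/eqP-> /eqP->]. Qed.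

Lemma phi_fix_point s w : phi (Point s) w = Some w ->
  odd (size (fixed_terms X s)) /\ w = Term (last (0, [::]) (fixed_terms X s)).
Proof.
by move=> /phi_point[t [-> [Et] /point_mate_fix]] => /(_ (esym Et))[? {1}->].
Qed.

Lemma phi_fix_unique v w w' : phi v w = Some w -> phi v w' = Some w' -> w = w'.
Proof.
case: v => [s|t|t t'].
- by move=> /phi_fix_point[_ ->] /phi_fix_point[_ ->].
- by move=> /phi_fix_term[_ _ _ ->] /phi_fix_term[_ _ _ ->].
- by move=> /phi_fix_leaf[_ ->] /phi_fix_leaf[_ ->].
Qed.

(** For the exceptional occurrence this gives the starting node of End of the Line, with the point
    of ones as its neighbour left alone. *)
Lemma phi_ones t : is_occurrence X t -> link t = None ->
  phi (Term t) (all_ones X) = Some (all_ones X).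
Proof.
move=> occ_t El; rewrite /phi /= El /= coords_ones_mate // eqxx /=.
by have /andP[-> _] := occ_t; rewrite -{1}(size_exponents X t) in_coords_ones.
Qed.

Definition is_vertex (v : node) : bool :=
  match v with
  | Point s => size s == X.1
  | Term t => is_termb X t
  | Leaf t t' => link t == Some v
  end.

Lemma phi_vertex v w : phi v w -> is_vertex v.
Proof.
case: v => [s|t|t t'].
- case E: (phi _ _) => [w'|] // _; have [t [_ _]] := phi_point E.
  by case/and3P.
- by rewrite /phi /=; case: ifP => // /andP[].
- by rewrite /phi /=; case: ifP => // /andP[].
Qed.

End PairedGraph.

(** * Vertices as binary words *)

Lemma ptime_retype (A B C : encType) (f : A -> B) (g : A -> C) :
  (forall x, enc (f x) = enc (g x)) -> ptime f -> ptime g.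
Proof.
by move=> Efg [p rp]; exists p; apply: runs_poly_eq rp => x _; rewrite Efg.
Qed.

(** The tags agree with those of [cn_enc_cand]: the code of a point is that of a candidate nonzero
    point, the code of a leaf that of a candidate pairing violation. *)
Definition enc_node (v : node) : data :=
  match v with
  | Point s => enc (0, s)
  | Term t => enc (1, t)
  | Leaf t t' => enc (2, (t, t'))
  end.

Lemma enc_node_inj : injective enc_node.
Proof.
move=> [s|t|t u] [s'|t'|t' u'] //= /enc_inj; try discriminate.
- by case=> ->.
- by case: t t' => [i a] [i' a'] [-> ->].
- by case: t u t' u' => [i a] [j b] [i' a'] [j' b'] [-> -> -> ->].
Qed.

HB.instance Definition _ := HasEncoding.Build node enc_node_inj.

Fixpoint dec_list (d : data) : seq data := if d is DCons a b then a :: dec_list b else [::].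

Definition dec_nat (d : data) : nat := size (dec_list d).
Definition dec_bool (d : data) : bool := if d is DCons _ _ then true else false.
Definition dec_bits (d : data) : seq bool := [seq dec_bool a | a <- dec_list d].
Definition dec_term (d : data) : term :=
  if d is DCons a b then (dec_nat a, [seq dec_nat c | c <- dec_list b]) else (0, [::]).

Lemma dec_listK (B : encType) (l : seq B) : dec_list (enc l) = [seq enc b | b <- l].
Proof. by elim: l => //= b l <-. Qed.

Lemma enc_dec_list (d : data) : enc (dec_list d) = d.
Proof. by elim: d => // a _ b IH; rewrite -[LHS]/(DCons a (enc (dec_list b))) IH. Qed.

Lemma dec_natK : cancel (@enc nat) dec_nat.
Proof. by elim=> // n IH; rewrite -[LHS]/(dec_nat (enc n)).+1 IH. Qed.

Lemma dec_bitsK : cancel (@enc (seq bool)) dec_bits.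
Proof.
move=> s; rewrite /dec_bits dec_listK -map_comp; apply: map_id_in => b _.
by case: b.
Qed.

Lemma dec_termK : cancel (@enc term) dec_term.
Proof.
case=> i a; rewrite -[LHS]/(dec_nat (enc i), [seq dec_nat c | c <- dec_list (enc a)]).
rewrite dec_natK dec_listK -map_comp; congr pair.
by apply: map_id_in => n _; exact: dec_natK.
Qed.

(** The decoders are total and accept any tree; encoding again and comparing rejects everything that
    is not a code. *)
Definition dec_if (B : encType) (dec : data -> B) (d : data) : option B :=
  if enc (dec d) == d then Some (dec d) else None.

Lemma dec_ifP (B : encType) (dec : data -> B) (d : data) (b : B) :
  cancel enc dec -> (dec_if dec d = Some b <-> d = enc b).
Proof.
move=> decK; rewrite /dec_if; case: eqP => [E|nE]; split=> //.
- by case=> <-.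
- by move=> ->; rewrite decK.
- by move=> Ed; case: nE; rewrite Ed decK.
Qed.

Definition dec_node (d : data) : node :=
  if d is DCons a b then
    if a == enc 0 then Point (dec_bits b)
    else if a == enc 1 then Term (dec_term b)
    else if b is DCons c e then Leaf (dec_term c) (dec_term e)
    else Leaf (0, [::]) (0, [::])
  else Point [::].

Lemma dec_nodeK : cancel (@enc node) dec_node.
Proof.
case=> [s|t|t u].
- by rewrite -[enc _]/(DCons (enc 0) (enc s)) /= eqxx dec_bitsK.
- rewrite -[enc _]/(DCons (enc 1) (enc t)) /= !(inj_eq (@enc_inj _)) /=.
  by congr Term; exact: dec_termK.
- rewrite -[enc _]/(DCons (enc 2) (DCons (enc t) (enc u))) /=.
  by rewrite !(inj_eq (@enc_inj _)) /=; congr Leaf; exact: dec_termK.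
Qed.

(** Polish notation, with one digit for each unit of [dsize]. *)
Fixpoint serialize (d : data) : seq bool :=
  if d is DCons a b then true :: serialize a ++ serialize b else [:: false].

Definition parse_step (b : bool) (st : seq data) : seq data :=
  if b then
    if st is a :: st' then
      if st' is c :: st'' then DCons a c :: st'' else [:: a]
    else [::]
  else DNil :: st.

(* The digits are read backwards, so the padding by [false] after a serialized
   tree only leaves junk at the bottom of the stack. *)
Definition parse (s : seq bool) : data := head DNil (foldr parse_step [::] s).

Lemma size_serialize (d : data) : size (serialize d) = dsize d.
Proof. by elim: d => //= a IHa b IHb; rewrite size_cat IHa IHb. Qed.

Lemma parse_serialize (d : data) (s : seq bool) : parse (serialize d ++ s) = d.
Proof.
suff foldE st r : foldr parse_step st (serialize d ++ r) =
    d :: foldr parse_step st r by rewrite /parse foldE.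
by elim: d r => //= a IHa b IHb r; rewrite -catA IHa IHb.
Qed.

Definition pad (n : nat) (d : data) : seq bool :=
  take n (serialize d ++ nseq n false).

Lemma size_pad n d : size (pad n d) = n.
Proof. by rewrite size_take_min size_cat size_nseq; apply/minn_idPl/leq_addl. Qed.

Lemma parse_pad n d : dsize d <= n -> parse (pad n d) = d.
Proof.
by rewrite -size_serialize => le_n; rewrite /pad take_cat ltnNge le_n parse_serialize.
Qed.

(** Comparing [w] with the padding of what it decodes to ensures that no vertex is represented by
    two words. *)
Definition word_node (n : nat) (w : seq bool) : option node :=
  if pad n (parse w) == w then dec_if dec_node (parse w) else None.

Lemma word_nodeK n v : dsize (enc v) <= n -> word_node n (pad n (enc v)) = Some v.
Proof.
by move=> le_n; rewrite /word_node parse_pad // eqxx; apply/(dec_ifP _ _ dec_nodeK).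
Qed.

Lemma word_node_pad n w v : word_node n w = Some v -> pad n (enc v) = w.
Proof.
rewrite /word_node; case: eqP => // Ew /(dec_ifP _ _ dec_nodeK) Ev.
by rewrite -Ev.
Qed.

(** The tests on [t'] are those of [paired_to], with [ans] in place of the program. [ans] is read at
    occurrences only, and the exceptional occurrence is never linked. *)
Definition link_of X (ans : term -> data) t : option node :=
  if is_occurrence X t && (t != X.2.2.2) then
    if dec_if dec_term (ans t) is Some t' then
      if [&& is_occurrence X t', t' != t & t' != X.2.2.2] then
        Some (if ans t' == enc t then Term t' else Leaf t t')
      else None
    else None
  else None.

Section LinkOf.
Variables (X : instance) (ans : term -> data).

Lemma link_of_occ t v : link_of X ans t = Some v -> is_occurrence X t.
Proof. by rewrite /link_of; case: ifP => // /andP[]. Qed.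

Lemma link_of_exc : link_of X ans X.2.2.2 = None.
Proof. by rewrite /link_of eqxx andbF. Qed.

Lemma link_ofP t v : link_of X ans t = Some v ->
  (exists t', [/\ v = Term t', t' != t & link_of X ans t' = Some (Term t)]) \/
  (exists t', v = Leaf t t').
Proof.
rewrite {1}/link_of; case: ifP => // /andP[occ_t ne_t].
case Et': (dec_if _ _) => [t'|] //; case: ifP => // /and3P[occ_t' ne_t' ne_t'_exc] [<-].
case: eqP => [Et|_]; [left | right]; exists t' => //; split=> //.
have ans_t : ans t = enc t' by apply/(dec_ifP _ _ dec_termK).
rewrite /link_of occ_t' ne_t'_exc (_ : dec_if _ _ = Some t) /=; last first.
  exact/(dec_ifP _ _ dec_termK).
by rewrite occ_t eq_sym ne_t' ne_t ans_t eqxx.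
Qed.

End LinkOf.

(** * Polynomial-time algorithms for the graph *)

Ltac pt_lists ::= first
  [ refine (ptime_map _ _) | refine (ptime_filter _ _) | refine (ptime_all _ _)
  | refine (ptime_zip _ _) | refine (ptime_cat _ _) | refine (ptime_rev _)
  | refine (ptime_size _) | refine (ptime_nth _ _ _) | refine (ptime_last _ _)
  | refine (ptime_index _ _) | refine (ptime_mem _ _) | refine (ptime_iota _)
  | refine (ptime_nseq _ _) | refine (ptime_sumn _) | refine (ptime_odd _)
  | refine (ptime_addn _ _) | refine (ptime_subn _ _) | refine (ptime_leq _ _)
  | refine (ptime_drop _ _) ].

Lemma ptime_predn (A : encType) (f : A -> nat) : ptime f -> ptime (fun x => (f x).-1).
Proof.
move=> pf; apply: (@eq_ptime _ _ (fun x => if f x is n.+1 then n else 0)); last by pt.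
by move=> x; case: (f x).
Qed.

Ltac pt_user ::= refine (ptime_predn _).

Lemma ptime_mate (A : encType) :
  ptime (fun z : seq A * A => mate z.1 z.2).
Proof. by rewrite /mate; pt. Qed.

Ltac pt_user ::= first [refine (ptime_predn _) | refine (ptime_comp2 (ptime_mate _) _ _)].

(** The recursion becomes a fold whose flag records that a coordinate has already moved; from then
    on entries are copied. *)
Lemma ptime_product_mate (A : encType) :
  ptime (fun zs : seq (seq A * A) => product_mate zs).
Proof.
pose m (z : seq A * A) := mate z.1 z.2.
pose g (acc : bool * seq A) (z : seq A * A) :=
  let a := if acc.1 then z.2 else m z in (acc.1 || (a != z.2), a :: acc.2).
have pm : ptime m by exact: ptime_mate.
have H : ptime (fun zs : seq (seq A * A) => foldl g (false, [::]) zs).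
  apply: (@ptime_foldl _ _ _ _ (fun=> (false, [::])) (fun=> g)).
  - exact: ptime_id.
  - exact: ptime_const.
  - by rewrite /g; pt.
  have [d dP] := @elem_bounded _ _ _ (fun zs : seq (seq A * A) => zs) (fun _ => m)
    (ptime_id _) (ptime_comp pm (ptime_snd (ptime_id _))).
  exists (d + 'X + 4%N%:P)%R => zs [b l] z zs_z.
  rewrite !horner_natD horner_natC hornerX.
  rewrite -[g _ _]/(b || ((if b then z.2 else m z) != z.2),
                    (if b then z.2 else m z) :: l).
  rewrite !dsize_pair dsize_cons !dsize_bool.
  have := dP zs z zs_z; have := dsize_mem zs_z.
  have : dsize (enc z.2) <= dsize (enc z).
    by case: (z) => z1 z2; rewrite dsize_pair /=; lia.
  by case: b => /=; case: (m z != z.2) => /=; lia.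
apply: eq_ptime (ptime_rev (ptime_snd H)) => zs.
have gE b (s : seq (seq A * A)) l : (foldl g (b, l) s).2 =
    catrev (if b then unzip2 s else product_mate s) l.
  elim: s b l => [|[L a] s IH] b l; first by case: b.
  rewrite [foldl _ _ _]/= /g /= IH; case: b => //=; rewrite /m /=.
  by case: eqP => [->|].
by rewrite gE -[RHS]revK.
Qed.

Lemma ptime_nonvanishing :
  ptime (fun z : seq nat * seq bool => nonvanishing z.1 z.2).
Proof. by rewrite /nonvanishing; pt. Qed.

Lemma ptime_live : ptime (fun z : seq (seq nat) * seq bool => live z.1 z.2).
Proof.
by rewrite /live; pt.
Qed.

Lemma ptime_choices : ptime (fun z : seq (seq (seq nat)) * seq bool => choices z.1 z.2).
Proof.
by rewrite /choices; pt.
Qed.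

Lemma ptime_block : ptime (fun z : instance * nat => block z.1 z.2).
Proof. by rewrite /block; pt. Qed.

Ltac pt_user ::= first
  [ refine (ptime_predn _) | refine (ptime_comp2 (ptime_mate _) _ _)
  | refine (ptime_comp (ptime_product_mate _) _)
  | refine (ptime_comp2 ptime_nonvanishing _ _)
  | refine (ptime_comp2 ptime_live _ _)
  | refine (ptime_comp2 ptime_choices _ _)
  | refine (ptime_comp2 ptime_block _ _) ].

Lemma ptime_in_product (A : encType) :
  ptime (fun z : seq (seq A) * seq A => in_product z.1 z.2).
Proof. by rewrite /in_product; pt. Qed.

Lemma ptime_incident :
  ptime (fun z : instance * seq bool * term => incident z.1.1 z.1.2 z.2).
Proof.
by rewrite /incident; pt.
Qed.

Lemma ptime_is_term : ptime (fun z : instance * term => is_termb z.1 z.2).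
Proof.
by rewrite /is_termb; pt.
Qed.

Lemma ptime_exponents : ptime (fun z : instance * term => exponents z.1 z.2).
Proof. by rewrite /exponents; pt. Qed.

Lemma ptime_coords : ptime (fun e : seq nat => coords e).
Proof. by rewrite /coords; pt. Qed.

Lemma ptime_fixed_terms : ptime (fun z : instance * seq bool => fixed_terms z.1 z.2).
Proof. by rewrite /fixed_terms; pt. Qed.

Ltac pt_user ::= first
  [ refine (ptime_predn _) | refine (ptime_comp2 (ptime_mate _) _ _)
  | refine (ptime_comp (ptime_product_mate _) _)
  | refine (ptime_comp2 ptime_choices _ _)
  | refine (ptime_comp2 ptime_block _ _)
  | refine (ptime_comp2 (ptime_in_product _) _ _)
  | refine (ptime_comp3 ptime_incident _ _ _)
  | refine (ptime_comp2 ptime_is_term _ _)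
  | refine (ptime_comp2 ptime_exponents _ _)
  | refine (ptime_comp ptime_coords _)
  | refine (ptime_comp2 ptime_fixed_terms _ _) ].

Lemma ptime_point_mate :
  ptime (fun z : instance * seq bool * term => point_mate z.1.1 z.1.2 z.2).
Proof. by rewrite /point_mate; pt. Qed.

Lemma ptime_is_occurrence : ptime (fun z : instance * term => is_occurrence z.1 z.2).
Proof. by rewrite /is_occurrence; pt. Qed.

(** A tree and the list of trees along its right spine have the same encoding, so the decoder costs
    nothing. *)
Lemma ptime_dec_list (A : encType) (f : A -> data) :
  ptime f -> ptime (fun x => dec_list (f x)).
Proof. by apply: ptime_retype => x; rewrite enc_dec_list. Qed.

Lemma ptime_dec_bits : ptime (fun d : data => dec_bits d).
Proof.
rewrite /dec_bits /dec_bool.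
by refine (ptime_map _ _); [pt | apply: ptime_dec_list; pt].
Qed.

Lemma ptime_dec_nat (A : encType) (f : A -> data) :
  ptime f -> ptime (fun x => dec_nat (f x)).
Proof. by move=> pf; rewrite /dec_nat; apply/ptime_size/ptime_dec_list. Qed.

Lemma ptime_dec_term : ptime (fun d : data => dec_term d).
Proof.
rewrite /dec_term; refine (ptime_case_data _ _ _); [pt | pt |].
refine (ptime_pair _ _); first by apply: ptime_dec_nat; pt.
refine (ptime_map _ _); last by apply: ptime_dec_list; pt.
by apply: ptime_dec_nat; pt.
Qed.

Section NodeCases.
Variables A C : encType.

Lemma ptime_Point (f : A -> seq bool) : ptime f -> ptime (fun x => Point (f x)).
Proof.
by move=> pf; apply: (@ptime_retype A _ _ (fun x => (0, f x))) => //; pt.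
Qed.

Lemma ptime_Term (f : A -> term) : ptime f -> ptime (fun x => Term (f x)).
Proof.
by move=> pf; apply: (@ptime_retype A _ _ (fun x => (1, f x))) => //; pt.
Qed.

Lemma ptime_Leaf (f g : A -> term) :
  ptime f -> ptime g -> ptime (fun x => Leaf (f x) (g x)).
Proof.
by move=> pf pg; apply: (@ptime_retype A _ _ (fun x => (2, (f x, g x)))) => //; pt.
Qed.

Lemma ptime_case_node (v : A -> node) (f : A -> seq bool -> C) (g : A -> term -> C)
    (h : A -> term -> term -> C) :
  ptime v -> ptime (fun z : A * seq bool => f z.1 z.2) ->
  ptime (fun z : A * term => g z.1 z.2) ->
  ptime (fun z : A * term * term => h z.1.1 z.1.2 z.2) ->
  ptime (fun x => match v x with
                  | Point s => f x s
                  | Term t => g x t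
                  | Leaf t t' => h x t t'
                  end).
Proof.
move=> pv pf pg ph; have pd := ptime_enc pv.
have pb (B : encType) (k : B -> data) : ptime k -> ptime (fun x => dec_bits (k x)).
  exact: ptime_comp ptime_dec_bits.
have pterm (B : encType) (k : B -> data) : ptime k -> ptime (fun x => dec_term (k x)).
  exact: ptime_comp ptime_dec_term.
(* The match is carried out on the code of the node. The two values [f x [::]] are never reached on
   codes of nodes. *)
apply: (@eq_ptime _ _ (fun x => if enc (v x) is DCons a b then
    if a == enc 0 then f x (dec_bits b)
    else if a == enc 1 then g x (dec_term b)
    else if b is DCons c e then h x (dec_term c) (dec_term e)
    else f x [::] else f x [::])).
  move=> x; case: (v x) => [s|t|t t'].
  - by rewrite -[enc _]/(DCons (enc 0) (enc s)) /= eqxx dec_bitsK.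
  - rewrite -[LHS]/(if enc 1 == enc 0 then _ else if enc 1 == enc 1 then
      g x (dec_term (enc t)) else _).
    by rewrite !(inj_eq (@enc_inj _)) dec_termK.
  - rewrite -[LHS]/(if enc 2 == enc 0 then _ else if enc 2 == enc 1 then _ else
      h x (dec_term (enc t)) (dec_term (enc t'))).
    by rewrite !(inj_eq (@enc_inj _)) !dec_termK.
refine (ptime_case_data pd _ _).
  by refine (ptime_comp2 pf _ _); pt.
refine (ptime_if _ _ _); first by pt.
  by refine (ptime_comp2 pf _ _); [pt | refine (pb _ _ _); pt].
refine (ptime_if _ _ _); first by pt.
  by refine (ptime_comp2 pg _ _); [pt | refine (pterm _ _ _); pt].
refine (ptime_case_data _ _ _); first by pt.
  by refine (ptime_comp2 pf _ _); pt.
by refine (ptime_comp3 ph _ _ _); [pt | refine (pterm _ _ _); pt | refine (pterm _ _ _); pt].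
Qed.

End NodeCases.

(** Serialization without recursion: a stack of subtrees still to be written, and the output in
    reverse order. *)
Definition serialize_step (z : seq data * seq bool) : seq data * seq bool :=
  if z.1 is d :: st then
    if d is DCons a b then (a :: b :: st, true :: z.2) else (st, false :: z.2)
  else z.

Lemma iter_serialize_step (d : data) (st : seq data) (out : seq bool) (k : nat) :
  iter (k + dsize d) serialize_step (d :: st, out) =
  iter k serialize_step (st, catrev (serialize d) out).
Proof.
elim: d st out k => [|a IHa b IHb] st out k; first by rewrite addn1 iterSr.
rewrite [dsize _]/= addnS iterSr -[serialize_step _]/(a :: b :: st, true :: out).
by rewrite [dsize a + _]addnC addnA IHa IHb /= catrev_catl.
Qed.

(** Each step writes one digit and removes one unit from the total size of the stack, so all states
    stay linear in the size of [d]. *)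
Lemma serialize_step_size (d : data) (j : nat) : j <= dsize d ->
  let z := iter j serialize_step ([:: d], [::]) in
  sumn [seq dsize a | a <- z.1] + j = dsize d /\ size z.2 = j.
Proof.
elim: j => [|j IH] lt_j; first by rewrite /= !addn0.
have [] := IH (ltnW lt_j); rewrite [iter j.+1 _ _]iterS.
case: (iter j _ _) => [[|[|a b] st] out] /=; lia.
Qed.

Lemma ptime_serialize (A : encType) (f : A -> data) :
  ptime f -> ptime (fun x => serialize (f x)).
Proof.
move=> pf.
pose cond (z : seq data * seq bool) := if z.1 is _ :: _ then true else false.
pose init x : seq data * seq bool := ([:: f x], [::]).
have pinit : ptime init by rewrite /init; pt.
have pcond : ptime cond by rewrite /cond; pt.
have pstep : ptime serialize_step by rewrite /serialize_step; pt.
have [c cP] := ptime_bounded pf.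
have enc_listE (l : seq data) : dsize (enc l) = (sumn [seq dsize a | a <- l] + size l).+1.
  exact: dsize_seq.
have le_size (l : seq data) : size l <= sumn [seq dsize a | a <- l].
  by elim: l => //= a l; have := dsize_gt0 a; lia.
have le_bits (l : seq bool) : dsize (enc l) <= (4 * size l).+1.
  rewrite mulnC; apply: (dsize_seq_le (k := 3)) => b _.
  by rewrite dsize_bool; case: b.
(* A digit costs at most 4 in the output, and a unit of stack size at most 2; the additive 4 covers
   the ends of both lists and the pairing. *)
have H := @ptime_while A _ init cond serialize_step (fun x => dsize (f x)) (4%N%:P * c + 4%N%:P)%R
  pinit pcond pstep.
have {}H : ptime (fun x => iter (dsize (f x)) serialize_step (init x)).
  apply: H => [x|x j le_j|x j lt_j|x].
  - rewrite horner_natD horner_natM !horner_natC.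
    by have := cP x Logic.I; rewrite -[enc (f x)]/(f x); lia.
  - have := cP x Logic.I; rewrite -[enc (f x)]/(f x).
    rewrite horner_natD horner_natM !horner_natC /init.
    have [] := serialize_step_size le_j.
    case: (iter j _ _) => st out; rewrite [(_, _).1]/= [(_, _).2]/= => Est Eout.
    have := le_size st; have := le_bits out.
    rewrite dsize_pair enc_listE; lia.
  - have [] := serialize_step_size (ltnW lt_j); rewrite /init /cond.
    by case: (iter j _ _) => [[|//] out] /= Ej _; move: lt_j; rewrite -Ej ltnn.
  - by rewrite /init -[dsize _]add0n iter_serialize_step.
apply: eq_ptime (ptime_rev (ptime_snd H)) => x.
by rewrite /init -[dsize _]add0n iter_serialize_step -[RHS]revK.
Qed.

Lemma ptime_parse (A : encType) (f : A -> seq bool) :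
  ptime f -> ptime (fun x => parse (f x)).
Proof.
move=> pf; have prf := ptime_rev pf.
have H : ptime (fun x => foldl (fun st b => parse_step b st) [::] (rev (f x))).
  apply: (@ptime_foldl _ _ _ _ (fun=> [::]) (fun _ st b => parse_step b st) prf).
  - exact: ptime_const.
  - by rewrite /parse_step; pt.
  exists (2%N%:P)%R => x st b _; rewrite horner_natC.
  case: b; last by rewrite -[parse_step _ _]/(DNil :: st) dsize_cons [dsize (enc DNil)]/=; lia.
  case: st => [|a [|c st]]; [exact: leq_addr | exact: leq_addr |].
  rewrite -[parse_step _ _]/(DCons a c :: st) !dsize_cons.
  by rewrite -[enc (DCons a c)]/(DCons (enc a) (enc c)) [dsize (DCons _ _)]/=; lia.
have H' : ptime (fun x => if foldl (fun st b => parse_step b st) [::] (rev (f x)) is d :: _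
    then d else DNil) by refine (ptime_case_seq H _ _); pt.
apply: eq_ptime H' => x; rewrite /parse -[f x in RHS]revK -foldl_rev revK.
by case: foldl.
Qed.

Lemma ptime_take (A B : encType) (n : A -> nat) (l : A -> seq B) :
  ptime n -> ptime l -> ptime (fun x => take (n x) (l x)).
Proof.
move=> pn pl; have H : ptime (fun x => rev (drop (size (l x) - n x) (rev (l x)))) by pt.
apply: eq_ptime H => x; rewrite drop_rev revK.
have [le_n|/ltnW le_n] := leqP (n x) (size (l x)); first by rewrite subKn.
by rewrite (eqP le_n) subn0 take_size take_oversize.
Qed.

Lemma ptime_pad : ptime (fun z : nat * data => pad z.1 z.2).
Proof.
rewrite /pad; refine (ptime_take _ _); first by pt.
by refine (ptime_cat (ptime_serialize _) _); pt.
Qed.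

Lemma ptime_dec_if (B : encType) (dec : data -> B) :
  ptime dec -> ptime (fun d => dec_if dec d).
Proof. by move=> pdec; rewrite /dec_if; pt. Qed.

Lemma ptime_dec_node : ptime (fun d : data => dec_node d).
Proof.
rewrite /dec_node; pose pb := ptime_dec_bits; pose pterm := ptime_dec_term.
refine (ptime_case_data _ _ _); [pt | exact: ptime_const |].
refine (ptime_if _ _ _); first by pt.
  by refine (ptime_Point (ptime_comp pb _)); pt.
refine (ptime_if _ _ _); first by pt.
  by refine (ptime_Term (ptime_comp pterm _)); pt.
refine (ptime_case_data _ _ _); [pt | exact: ptime_const |].
by refine (ptime_Leaf (ptime_comp pterm _) (ptime_comp pterm _)); pt.
Qed.

Lemma ptime_word_node : ptime (fun z : nat * seq bool => word_node z.1 z.2).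
Proof.
have pp : ptime (fun z : nat * seq bool => parse z.2) by apply: ptime_parse; pt.
rewrite /word_node; refine (ptime_if (ptime_eq _ _) _ _); [|by pt| |exact: ptime_const].
  by refine (ptime_comp2 ptime_pad _ _); pt.
by refine (ptime_comp (ptime_dec_if ptime_dec_node) _).
Qed.

(** The largest vertices are leaves, with two terms each of size at most twice that of the instance;
    the rest of the factor 8 absorbs tags and pairings. Being at least the size of the instance,
    this length also lets the algorithm handle its built-in instance in time polynomial in the word
    length. *)
Definition word_len X : nat := 8 * dsize (enc X).

Lemma ptime_word_len : ptime word_len.
Proof.
have pD : ptime (fun X : instance => size (serialize (enc X))).
  by refine (ptime_size (ptime_serialize _)); exact: ptime_enc (ptime_id _).
have H : ptime (fun X : instance => sumn (nseq 8 (size (serialize (enc X))))) by pt.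
by apply: eq_ptime H => X; rewrite size_serialize sumn_nseq mulnC.
Qed.

(* [d] and [d'] are the outputs of the pairing algorithm at [t] and at the
   occurrence that [d] encodes. *)
Definition link_with X t (d d' : data) : option node :=
  if is_occurrence X t && (t != X.2.2.2) then
    if dec_if dec_term d is Some t' then
      if [&& is_occurrence X t', t' != t & t' != X.2.2.2] then
        Some (if d' == enc t then Term t' else Leaf t t')
      else None
    else None
  else None.

Definition query1 X (v : seq bool) : option term :=
  if word_node (word_len X) v is Some v' then
    if linked_term v' is Some t then if is_occurrence X t then Some t else None else None
  else None.

Definition query2 X (d : data) : option term :=
  if dec_if dec_term d is Some t then if is_occurrence X t then Some t else None else None.

Definition answer X (v w : seq bool) (d d' : data) : option (seq bool) :=
  if word_node (word_len X) v is Some v' then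
    if word_node (word_len X) w is Some w' then
      let l := if linked_term v' is Some t then link_with X t d d' else None in
      if graph_mate X l v' w' is Some u then Some (pad (word_len X) (enc u)) else None
    else None
  else None.

Definition ans_at (ans : term -> data) (o : option term) : data :=
  if o is Some t then ans t else DNil.

(** A test that makes a query empty also fails in the evaluation of [answer], so the default answer
    [DNil] never influences the result. *)
Lemma answer_spec X (ans : term -> data) v w (d := ans_at ans (query1 X v))
    (d' := ans_at ans (query2 X d)) :
  answer X v w d d' =
  if word_node (word_len X) v is Some v' then
    if word_node (word_len X) w is Some w' then
      if phi X (link_of X ans) v' w' is Some u then Some (pad (word_len X) (enc u))
      else None
    else None
  else None.
Proof.
rewrite /answer; case Ev: (word_node _ v) => [v'|] //; case: (word_node _ w) => // w'.
rewrite /phi; case El: (linked_term v') => [t|] //.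
suff -> : link_with X t d d' = link_of X ans t by [].
rewrite /link_with /link_of /d' /d /query1 Ev El.
case occ_t: (is_occurrence X t) => //=; case: (t != _) => //.
rewrite /query2; case: (dec_if _ _) => // t'.
by case occ_t': (is_occurrence X t').
Qed.

Lemma ptime_linked_term (A : encType) (v : A -> node) :
  ptime v -> ptime (fun x => linked_term (v x)).
Proof. by move=> pv; rewrite /linked_term; refine (ptime_case_node pv _ _ _); pt. Qed.

Ltac pt_user ::= first
  [ refine (ptime_comp2 (ptime_in_product _) _ _)
  | refine (ptime_comp (ptime_product_mate _) _)
  | refine (ptime_comp3 ptime_incident _ _ _)
  | refine (ptime_comp2 ptime_is_term _ _)
  | refine (ptime_comp2 ptime_exponents _ _)
  | refine (ptime_comp ptime_coords _)
  | refine (ptime_comp3 ptime_point_mate _ _ _)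
  | refine (ptime_comp2 ptime_is_occurrence _ _)
  | refine (ptime_comp ptime_word_len _)
  | refine (ptime_comp2 ptime_word_node _ _)
  | refine (ptime_comp2 ptime_pad _ _)
  | refine (ptime_comp (ptime_dec_if ptime_dec_term) _)
  | refine (ptime_linked_term _)
  | refine (ptime_Point _) | refine (ptime_Term _) | refine (ptime_Leaf _ _) ].

Lemma ptime_all_ones : ptime all_ones.
Proof. by rewrite /all_ones; pt. Qed.

Lemma ptime_term_edge : ptime (fun z : instance * term * (option node * node) =>
  term_edge z.1.1 z.1.2 z.2.1 z.2.2).
Proof. by rewrite /term_edge; refine (ptime_case_node _ _ _ _); pt. Qed.

Lemma ptime_term_mate : ptime (fun z : instance * term * (option node * node) =>
  term_mate z.1.1 z.1.2 z.2.1 z.2.2).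
Proof.
pose p1 := ptime_all_ones.
rewrite /term_mate /odflt /oapp; refine (ptime_case_node _ _ _ _); [pt | | |].
- by pt.
- by refine (ptime_comp p1 _); pt.
- by refine (ptime_comp p1 _); pt.
Qed.

Lemma ptime_graph_mate : ptime (fun z : instance * option node * (node * node) =>
  graph_mate z.1.1 z.1.2 z.2.1 z.2.2).
Proof.
rewrite /graph_mate; refine (ptime_case_node _ _ _ _); first by pt.
- by refine (ptime_case_node _ _ _ _); pt.
- refine (ptime_if _ _ _); last exact: ptime_const.
    refine (ptime_andb _ _); first by pt.
    by apply: (ptime_comp ptime_term_edge (f := fun z => (z.1.1.1, z.2, (z.1.1.2, z.1.2.2)))); pt.
  refine (ptime_Some _).
  by apply: (ptime_comp ptime_term_mate (f := fun z => (z.1.1.1, z.2, (z.1.1.2, z.1.2.2)))); pt.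
- by pt.
Qed.

Lemma ptime_link_with : ptime (fun z : instance * term * (data * data) =>
  link_with z.1.1 z.1.2 z.2.1 z.2.2).
Proof. by rewrite /link_with; pt. Qed.

Lemma ptime_query1 : ptime (fun z : instance * seq bool => query1 z.1 z.2).
Proof. by rewrite /query1; pt. Qed.

Lemma ptime_query2 : ptime (fun z : instance * data => query2 z.1 z.2).
Proof. by rewrite /query2; pt. Qed.

Lemma ptime_answer : ptime (fun z : instance * (seq bool * seq bool) * (data * data) =>
  answer z.1.1 z.1.2.1 z.1.2.2 z.2.1 z.2.2).
Proof.
rewrite /answer; refine (ptime_case_option _ _ _); [by pt | exact: ptime_const |].
refine (ptime_case_option _ _ _); [by pt | exact: ptime_const |].
refine (ptime_case_option _ _ _); [ | exact: ptime_const | by pt].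
have pl : ptime (fun z : instance * (seq bool * seq bool) * (data * data) * node * node =>
    if linked_term z.1.2 is Some t then link_with z.1.1.1.1 t z.1.1.2.1 z.1.1.2.2 else None).
  refine (ptime_case_option _ _ _); [by pt | exact: ptime_const |].
  by apply: (ptime_comp ptime_link_with
    (f := fun z => (z.1.1.1.1.1, z.2, (z.1.1.1.2.1, z.1.1.1.2.2)))); pt.
apply: (ptime_comp ptime_graph_mate
  (f := fun z => (z.1.1.1.1, if linked_term z.1.2 is Some t then
     link_with z.1.1.1.1 t z.1.1.2.1 z.1.1.2.2 else None, (z.1.2, z.2)))).
by refine (ptime_pair (ptime_pair _ pl) _); pt.
Qed.

(** * Instances of the Combinatorial Nullstellensatz *)

Definition inst_of (x : cn_input) : instance :=
  (cn_m x,
    ([seq [seq [seq (u : seq nat) | u : 'X_{1.._} <- p] | p <- b] | b <- cn_blocks x],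
      (enc_prog (cn_pairing x), cn_exc x))).

Lemma enc_seq_map (A B : Type) (e : B -> data) (f : A -> B) (l : seq A) :
  enc_seq e (map f l) = enc_seq (fun a => e (f a)) l.
Proof. by elim: l => //= a l ->. Qed.

Lemma enc_seq_eq (A : Type) (e e' : A -> data) (l : seq A) :
  e =1 e' -> enc_seq e l = enc_seq e' l.
Proof. by move=> Ee; elim: l => //= a l ->; rewrite Ee. Qed.

(** Forgetting the dependent types does not change the code, so programs written for [instance] run
    on the given inputs as they are. *)
Lemma enc_inst_of (x : cn_input) : enc (inst_of x) = cn_enc x.
Proof.
rewrite /cn_enc /inst_of -[LHS]/(DCons _ (DCons _ (DCons _ _))).
congr (DCons _ (DCons _ _)).
rewrite -[LHS]/(enc_seq enc _) enc_seq_map; apply: enc_seq_eq => b.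
rewrite -[LHS]/(enc_seq enc _) enc_seq_map; apply: enc_seq_eq => p.
by rewrite -[LHS]/(enc_seq enc _) enc_seq_map.
Qed.

Section Correspondence.
Variable x : cn_input.
Local Notation X := (inst_of x).
Local Notation m := (cn_m x).

Lemma inst_well_formed : well_formed X.
Proof.
move=> b p u /mapP[b' _ ->] /mapP[p' _ ->] /mapP[u' _ ->].
exact: size_tuple.
Qed.

Lemma block_inst i :
  block X i = [seq [seq (u : seq nat) | u : 'X_{1.._} <- p] | p <- cn_block x i].
Proof.
rewrite /block /cn_block /=.
have [lt_i|le_i] := ltnP i (size (cn_blocks x)); first by rewrite (nth_map [::]).
by rewrite !nth_default // size_map.
Qed.

Lemma nth_block_inst i j : nth [::] (block X i) j =
  [seq (u : seq nat) | u : 'X_{1.._} <- nth [::] (cn_block x i) j].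
Proof.
rewrite block_inst; have [lt_j|le_j] := ltnP j (size (cn_block x i)).
  by rewrite (nth_map [::]).
by rewrite !nth_default // size_map.
Qed.

Lemma is_term_inst t : is_termb X t <-> is_term x t.
Proof.
rewrite is_term_nth block_inst !size_map.
by split=> -[lt_i szt H]; split=> // j /H; rewrite -block_inst nth_block_inst size_map.
Qed.

Lemma exponent_inst t (i : 'I_m) : is_term x t ->
  nth 0 (exponents X t) i = term_monomial x t i.
Proof.
case=> lt_t szt lt_a; rewrite nth_exponents // sumnE big_map.
rewrite -[term_monomial x t]/(\sum_(j < size (cn_block x t.1)) _)%MM mnm_sumE.
rewrite (big_nth ([::], 0)) size_zip block_inst size_map szt minnn big_mkord.
apply: eq_bigr => j _; rewrite nth_zip ?size_map // /= -block_inst nth_block_inst.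
by rewrite (nth_map 0%MM) ?lt_a // -tnth_nth.
Qed.

Lemma exponents_inst t : is_term x t ->
  exponents X t = [seq term_monomial x t i | i <- enum 'I_m].
Proof.
move=> term_t; apply: (@eq_from_nth _ 0).
  by rewrite size_exponents size_map size_enum_ord.
rewrite size_exponents => i lt_i; rewrite -[i]/(val (Ordinal lt_i)).
rewrite exponent_inst // (nth_map (Ordinal lt_i)) ?size_enum_ord //.
by rewrite nth_ord_enum.
Qed.

Lemma occurrence_inst t : is_occurrence X t <-> occurrence x t.
Proof.
rewrite /is_occurrence /occurrence; split.
  case/andP => /is_term_inst term_t /eqP Ee; split=> //; apply/mnmP => i.
  by rewrite -exponent_inst // Ee nth_nseq ltn_ord mnmE.
case=> term_t Em; apply/andP; split; first exact/is_term_inst.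
rewrite exponents_inst // Em; apply/eqP/(@eq_from_nth _ 0).
  by rewrite size_map size_enum_ord size_nseq.
move=> i; rewrite size_map size_enum_ord => lt_i.
by rewrite (nth_map (Ordinal lt_i)) ?size_enum_ord // mnmE nth_nseq lt_i.
Qed.

(** Without repetitions in [p] nothing cancels in characteristic 2, so the degree of a factor is at
    least that of each of its listed monomials. *)
Lemma factor_poly_coeff (p : seq 'X_{1..m}) u :
  uniq p -> u \in p -> ((factor_poly p)@_u = 1)%R.
Proof.
move=> uniq_p pu; rewrite /factor_poly raddf_sum /= (bigD1_seq u) //= mcoeffX eqxx.
by rewrite big1 ?addr0 // => v ne_v; rewrite mcoeffX (negbTE ne_v).
Qed.

Lemma factor_poly_degree (p : seq 'X_{1..m}) u :
  uniq p -> u \in p -> factor_poly p != 0%R /\ mdeg u <= mdegree (factor_poly p).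
Proof.
move=> uniq_p pu; have supp_u : u \in msupp (factor_poly p).
  by rewrite mcoeff_msupp factor_poly_coeff // oner_neq0.
split; first by apply: contraTneq supp_u => ->; rewrite msupp0.
by rewrite /mdegree; have := msize_mdeg_lt supp_u; case: (mmeasure _ _).
Qed.

Lemma degree_violation (q : {poly nat}) t : cn_valid x q -> is_term x t ->
  all (leq 1) (exponents X t) -> ~ occurrence x t -> degree_exceeds x t.1.
Proof.
move=> [_ uniqP _ _] term_t full_t nocc; have [lt_t szt lt_a] := term_t.
pose b := cn_block x t.1.
have b_in : b \in cn_blocks x by apply: mem_nth.
pose u j := nth 0%MM (nth [::] b j) (nth 0 t.2 j).
have uP j : j < size b -> factor_poly (nth [::] b j) != 0%R /\
    mdeg (u j) <= mdegree (factor_poly (nth [::] b j)).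
  move=> lt_j; apply: factor_poly_degree; last exact/mem_nth/lt_a.
  by have [] := uniqP b _ b_in (mem_nth [::] lt_j).
split=> //.
  by apply/(all_nthP [::]) => j lt_j; have [] := uP j lt_j.
apply: (@leq_trans (\sum_(j < size b) mdeg (u j)).+1.-1); last first.
  by rewrite [X in _ <= X](big_nth [::]) big_mkord; apply: leq_sum => j _;
    have [] := uP j (ltn_ord j).
rewrite /= -mdeg_sum -[(\sum_(j < _) _)%MM]/(term_monomial x t).
have le1 i : 1 <= term_monomial x t i.
  rewrite -exponent_inst //; apply: (allP full_t).
  by rewrite mem_nth // size_exponents.
(* A monomial of degree at most [m] with all [m] exponents positive is the product of all the
   variables, so [t] would be an occurrence. *)
rewrite ltnNge; apply/negP => le_m; apply: nocc; split=> //; apply/mnmP => i.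
rewrite mnmE; apply/eqP; rewrite eqn_leq le1 andbT leqNgt; apply/negP => gt_i.
move: le_m; rewrite mdegE (bigD1 i) //= leqNgt => /negP[].
rewrite -[X in X < _](card_ord m) -sum1_card (bigD1 i) //=.
by rewrite -addSn; apply: leq_add => //; apply: leq_sum => j _; apply: le1.
Qed.

End Correspondence.

(** * Values of the polynomial as parities *)

Section Evaluation.
Variable x : cn_input.
Local Notation X := (inst_of x).
Local Notation m := (cn_m x).

Lemma natr_F2 (n : nat) : (n%:R = (odd n)%:R :> 'F_2)%R.
Proof.
elim: n => // n IH; rewrite mulrS IH /=.
by case: odd => //; apply/val_inj.
Qed.

Variable v : m.-tuple 'F_2.
Definition point_of_tuple : seq bool := [seq (a != 0)%R | a <- v].
Local Notation s := point_of_tuple.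

Lemma F2_bool (a : 'F_2) : (a = (a != 0)%:R)%R.
Proof. by case: a => -[|[|//]] lt_a; apply/val_inj. Qed.

Lemma monomial_value (u : 'X_{1..m}) :
  (('X_[u] : {mpoly 'F_2[m]}).@[tnth v] = (nonvanishing u s)%:R)%R.
Proof.
have szs : size s = m by rewrite size_map size_tuple.
have factorE (i : 'I_m) :
    ((tnth v i) ^+ (u i) = ((nth 0%N u i == 0%N) || nth false s i)%:R)%R.
  rewrite (nth_map 0%R) ?size_tuple // -!tnth_nth.
  rewrite -[tnth (multinom_val u) i]/(u i).
  case: eqP => [->|/eqP nz_u]; first by rewrite expr0.
  rewrite {1}[tnth v i]F2_bool /=; case: (_ != _); first by rewrite expr1n.
  by rewrite expr0n (negbTE nz_u).
rewrite mevalX (eq_bigr _ (fun i _ => factorE i)).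
have szus : size (u : seq nat) = size s by rewrite size_tuple szs.
case: (nonvanishingP szus) => [nv|nv].
  by apply: big1 => i _; rewrite nv ?szs.
case: (boolP [forall i : 'I_m, (nth 0%N u i == 0%N) || nth false s i]).
  move=> /forallP H; case: nv => i; rewrite szs => lt_i.
  exact: (H (Ordinal lt_i)).
by case/forallPn => i /negbTE fi; rewrite (bigD1 i) //= fi mul0r.
Qed.

Lemma factor_value (p : seq 'X_{1..m}) :
  ((factor_poly p).@[tnth v] =
   (odd (size (live [seq (u : seq nat) | u : 'X_{1..m} <- p] s)))%:R)%R.
Proof.
rewrite /factor_poly raddf_sum -natr_F2 size_filter -sum1_count natr_sum.
rewrite -[X in iota 0 X]subn0 -/(index_iota 0 _) [RHS]big_mkcond size_map.
rewrite (big_nth 0%MM); apply: eq_big_nat => i /andP[_ lt_i].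
by rewrite [LHS]/= monomial_value (nth_map 0%MM) //; case: nonvanishing.
Qed.

(** The product of the parities of a block is 1 iff all its live lists have odd length, which is the
    filter condition in [fixed_terms]. *)
Lemma cn_poly_value :
  ((cn_poly x).@[tnth v] = (odd (size (fixed_terms X s)))%:R)%R.
Proof.
rewrite /cn_poly raddf_sum -natr_F2 size_map size_filter -sum1_count natr_sum.
rewrite -[X in iota 0 X]subn0 -/(index_iota 0 _) [RHS]big_mkcond size_map.
rewrite (big_nth [::]); apply: eq_big_nat => i /andP[_ lt_i].
rewrite [LHS]/= rmorph_prod block_inst /cn_block /choices.
elim: (nth _ _ i) => [|p b IH]; first by rewrite big_nil.
rewrite big_cons IH [X in (X * _)%R = _]/= factor_value /=.
by case: odd; rewrite ?mul1r ?mul0r.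
Qed.

End Evaluation.

(** * Parity of sets with an involution *)

Lemma even_involution (T : finType) (f : T -> T) (A : {set T}) :
  {in A, forall a, f a \in A} -> {in A, forall a, f (f a) = a} ->
  {in A, forall a, f a != a} -> ~~ odd #|A|.
Proof.
elim: {A}#|A| {-2}A (leqnn #|A|) => [|n IH] A le_A fA fK f_ne.
  by move: le_A; rewrite leqn0 => /eqP->.
have [->|[a Aa]] := set_0Vmem A; first by rewrite cards0.
have B_sub b : b \in A :\ a :\ f a -> [/\ b \in A, b != a & b != f a].
  by rewrite !inE => /and3P[].
rewrite (cardsD1 a) Aa (cardsD1 (f a)) !inE f_ne // fA // addnA /= negbK.
apply: IH => [|b /B_sub[Ab ne_a ne_fa]|b /B_sub[Ab _ _]|b /B_sub[Ab _ _]].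
- move: le_A; rewrite (cardsD1 a) Aa (cardsD1 (f a)) !inE f_ne // fA //=; lia.
- rewrite !inE fA // andbT; apply/andP; split.
    by apply: contraNneq ne_a => Eb; rewrite -(fK b) // Eb fK.
  by apply: contraNneq ne_fa => Eb; rewrite -(fK b) // Eb.
- exact: fK.
- exact: f_ne.
Qed.

Lemma odd_involution (T : finType) (f : T -> T) (A : {set T}) (w : T) :
  {in A, forall a, f a \in A} -> {in A, forall a, f (f a) = a} ->
  w \in A -> f w = w -> {in A, forall a, f a = a -> a = w} -> odd #|A|.
Proof.
move=> fA fK Aw fw fix_w; rewrite (cardsD1 w) Aw /=.
apply: (@even_involution _ f) => a /setD1P[ne_w Aa].
- rewrite !inE fA // andbT; apply: contraNneq ne_w => Ea.
  by rewrite -(fK a) // Ea fw.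
- exact: fK.
- by apply: contraNneq ne_w => /(fix_w a Aa)->.
Qed.

(** On the neighbours of [v] the function [phi v] is an involution, and [w] is its only fixed
    point. *)
Lemma degree_odd (V : finType) (E : rel V) (phi : V -> V -> option V) (v w : V) :
  pairing_function E phi -> phi v w = Some w -> odd (degree E v).
Proof.
move=> [phiN phiE phi1] fix_w.
have Ew : E v w by apply: contraT => /phiN; rewrite fix_w.
pose f a := odflt a (phi v a).
have fP a : E v a -> [/\ phi v a = Some (f a), E v (f a) & phi v (f a) = Some a].
  by move=> /phiE[b [Eb Evb Eb']]; rewrite /f Eb.
apply: (@odd_involution _ f _ w) => [a|a|||a]; rewrite ?inE //.
- by move=> /fP[].
- by move=> /fP[_ _ Ea]; rewrite {1}/f Ea.
- by rewrite /f fix_w.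
- by move=> /fP[Ea _ _] Efa; apply: (phi1 v) => //; rewrite Ea Efa.
Qed.

(** * Words over two letters and the size of vertices *)

Section Words.
Variable n : nat.

Definition bits_of (w : word 2 n) : seq bool := [seq (a : nat) == 1 | a : 'I_2 <- w].

Definition word_of (s : seq bool) : word 2 n :=
  [tuple inord (nth false s i) | i < n].

Lemma enc_bits_of (w : word 2 n) : enc (bits_of w) = enc_word w.
Proof.
rewrite /enc_word -[LHS]/(enc_seq enc _) enc_seq_map; apply: enc_seq_eq.
by case=> -[|[|//]].
Qed.

Lemma size_bits_of w : size (bits_of w) = n.
Proof. by rewrite size_map size_tuple. Qed.

Lemma bits_of_inj : injective bits_of.
Proof.
move=> w w' /eqP Ew; apply/val_inj/eqP.
rewrite -(inj_eq (inj_map (f := fun a : 'I_2 => (a : nat) == 1) _)) //.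
by move=> [[|[|//]] lt_a] [[|[|//]] lt_b] //= _; apply/val_inj.
Qed.

Lemma word_ofK s : size s = n -> bits_of (word_of s) = s.
Proof.
move=> szs; apply: (@eq_from_nth _ false); rewrite size_bits_of // => i lt_i.
rewrite (nth_map ord0) ?size_tuple // -[i]/(val (Ordinal lt_i)) -tnth_nth tnth_mktuple.
by rewrite inordK; case: nth.
Qed.

Lemma dsize_bits_of w : dsize (enc (bits_of w)) <= 4 * n + 1.
Proof.
rewrite -[in X in _ <= X](size_bits_of w) mulnC addn1.
by apply: (dsize_seq_le (k := 3)) => b _; rewrite dsize_bool; case: b.
Qed.

End Words.

(** A unary number costs 2 per unit and a list at least 2 per entry; hence an index into a list is
    no larger than the list. *)
Lemma size_dsize2 (A : encType) (l : seq A) : 2 * size l < dsize (enc l).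
Proof. by elim: l => // a l; rewrite dsize_cons /=; have := dsize_gt0 (enc a); lia. Qed.

Section VertexSize.
Variables (X : instance) (ans : term -> data).

Lemma dsize_term t : is_termb X t -> dsize (enc t) <= 2 * dsize (enc X).
Proof.
case: t => i a term_t; have [lt_i sza lt_a] := (is_term_nth _ _).1 term_t.
rewrite /= in lt_i sza lt_a; rewrite dsize_pair dsize_nat.
have block_in : block X i \in X.2.1 by exact: mem_nth.
have : dsize (enc X.2.1) + 2 <= dsize (enc X).
  by rewrite {2}[X]surjective_pairing {2}[X.2]surjective_pairing !dsize_pair; lia.
have := dsize_mem block_in.
suff : dsize (enc a) <= dsize (enc (block X i)).
  have : 2 * i < dsize (enc X.2.1).
    by apply: leq_ltn_trans (size_dsize2 _); rewrite leq_mul2l ltnW.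
  by lia.
elim: a (block X i) sza lt_a {term_t block_in} => [|k a IH] [|p b] // [sza] lt_a.
rewrite !dsize_cons dsize_nat.
have lt_k : k < size p := lt_a 0 isT.
have lt_a' j : j < size b -> nth 0 a j < size (nth [::] b j) by exact: (lt_a j.+1).
have := IH b sza lt_a'.
have : 2 * k < dsize (enc p).
  by apply: leq_ltn_trans (size_dsize2 _); rewrite leq_mul2l ltnW.
by lia.
Qed.

Lemma dsize_vertex v : is_vertex X (link_of X ans) v -> dsize (enc v) <= word_len X.
Proof.
(* Five components and four pairings; this pays for the tags of the vertices. *)
have X9 : 9 <= dsize (enc X).
  case: X => k [bs [d [i a]]]; rewrite !dsize_pair.
  have := dsize_gt0 (enc k); have := dsize_gt0 (enc bs); have := dsize_gt0 (enc d).
  by have := dsize_gt0 (enc i); have := dsize_gt0 (enc a); lia.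
rewrite /word_len; case: v => [s /eqP szs|t term_t|t t' link_t].
- rewrite -[enc _]/(enc (0, s)) dsize_pair.
  have : dsize (enc s) <= (size s * 4).+1.
    by apply: (dsize_seq_le (k := 3)) => b _; rewrite dsize_bool; case: b.
  have : dsize (enc X.1) <= dsize (enc X) by rewrite {2}[X]surjective_pairing dsize_pair; lia.
  by rewrite szs !dsize_nat; lia.
- rewrite -[enc _]/(enc (1, t)) dsize_pair dsize_nat.
  by have := dsize_term term_t; lia.
- rewrite -[enc _]/(enc (2, (t, t'))) (dsize_pair 2 (t, t')) (dsize_pair t t') dsize_nat.
  move: link_t => /eqP; rewrite /link_of; case: ifP => // /andP[/andP[term_t _] _].
  case: (dec_if _ _) => // t1; case: ifP => // /and3P[/andP[term_t1 _] _ _].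
  case: eqP => // _ Et; have {Et}-> : t' = t1 by case: Et.
  by have := dsize_term term_t; have := dsize_term term_t1; lia.
Qed.

End VertexSize.

(** * The graph on words *)

(** A total function is needed although the program may diverge outside the occurrences; an
    arbitrary value is chosen there. *)
Definition pairing_output (x : cn_input) (t : term) : data :=
  epsilon (inhabits DNil) (fun d => exists n, eval (cn_pairing x) (enc_term t) d n).

Lemma pairing_outputP (x : cn_input) t d n :
  eval (cn_pairing x) (enc_term t) d n -> pairing_output x t = d.
Proof.
move=> ev; have [k ev'] := epsilon_spec (inhabits DNil)
  (fun d => exists n, eval (cn_pairing x) (enc_term t) d n) (ex_intro _ d (ex_intro _ n ev)).
exact: eval_det ev' ev.
Qed.

Section WordGraph.
Variable x : cn_input.
Local Notation X := (inst_of x).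
Local Notation n := (word_len X).
Local Notation link := (link_of X (pairing_output x)).

Definition vertex_of (w : word 2 n) : option node := word_node n (bits_of w).

Definition vertex_word (v : node) : word 2 n := word_of n (pad n (enc v)).

(** A word that stands for no vertex gets no neighbour. *)
Definition word_phi (v w : word 2 n) : option (word 2 n) :=
  if vertex_of v is Some v' then
    if vertex_of w is Some w' then
      if phi X link v' w' is Some u then Some (vertex_word u) else None
    else None
  else None.

Lemma bits_vertex_word v : bits_of (vertex_word v) = pad n (enc v).
Proof. by rewrite word_ofK ?size_pad. Qed.

Lemma vertex_wordK v : is_vertex X link v -> vertex_of (vertex_word v) = Some v.
Proof.
by move=> /dsize_vertex le_v; rewrite /vertex_of bits_vertex_word word_nodeK.
Qed.

Lemma vertex_of_word w v : vertex_of w = Some v -> vertex_word v = w.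
Proof.
by move=> /word_node_pad Ew; apply: bits_of_inj; rewrite bits_vertex_word.
Qed.

Let wfX := @inst_well_formed x.
Let link_occ := @link_of_occ X (pairing_output x).
Let linkP := @link_ofP X (pairing_output x).

(** Only true vertices lie on edges, so everything that [phi] returns fits into a word and can be
    recovered from it. *)
Lemma phi_vertices v w u : phi X link v w = Some u ->
  [/\ is_vertex X link v, is_vertex X link w & is_vertex X link u].
Proof.
move=> E; have E' := phi_mateK link_occ linkP E.
have v_w : phi X link v w by rewrite E.
have v_u : phi X link v u by rewrite E'.
by split; [exact: phi_vertex v_w | |]; apply: phi_vertex;
  [exact: phi_sym v_w | exact: phi_sym v_u].
Qed.

Lemma word_phiE v w u : phi X link v w = Some u ->
  word_phi (vertex_word v) (vertex_word w) = Some (vertex_word u).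
Proof.
by move=> E; have [Vv Vw _] := phi_vertices E; rewrite /word_phi !vertex_wordK // E.
Qed.

Lemma word_phiP a b c : word_phi a b = Some c -> exists v w u,
  [/\ a = vertex_word v, b = vertex_word w, c = vertex_word u & phi X link v w = Some u].
Proof.
rewrite /word_phi; case Ea: (vertex_of a) => [v|] //; case Eb: (vertex_of b) => [w|] //.
case Eu: (phi _ _ _ _) => [u|] // [<-]; exists v, w, u.
by rewrite (vertex_of_word Ea) (vertex_of_word Eb).
Qed.

Lemma vertex_word_inj v w : is_vertex X link v -> is_vertex X link w ->
  vertex_word v = vertex_word w -> v = w.
Proof. by move=> /vertex_wordK Ev /vertex_wordK + E; rewrite -E Ev => -[]. Qed.

Lemma word_pairing_function : pairing_function (fun v w => word_phi v w : bool) word_phi.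
Proof.
split=> [a b|a b|a b c].
- by case: (word_phi a b).
- case E: (word_phi a b) => [c|] // _; exists c.
  have [v [w [u [-> -> -> Eu]]]] := word_phiP E.
  have Eu' := word_phiE (phi_mateK link_occ linkP Eu).
  by rewrite Eu'.
- move=> /word_phiP[v [w [u [-> -> Ewu Eu]]]] /word_phiP[v' [w' [u' [Ev -> Ewu' Eu']]]].
  have [Vv Vw Vu] := phi_vertices Eu; have [Vv' Vw' Vu'] := phi_vertices Eu'.
  have ? := vertex_word_inj Vv Vv' Ev; have ? := vertex_word_inj Vw Vu Ewu.
  have ? := vertex_word_inj Vw' Vu' Ewu'; subst v' u u'.
  by rewrite (phi_fix_unique linkP Eu Eu').
Qed.

Lemma word_phi_irrefl : irreflexive (fun v w => word_phi v w : bool).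
Proof.
move=> a; rewrite /word_phi; case: (vertex_of a) => [v|] //.
by rewrite phi_irrefl //; exact: linkP.
Qed.

Lemma word_phi_sym : ssrbool.symmetric (fun v w => word_phi v w : bool).
Proof.
have imp a b : word_phi a b -> word_phi b a.
  case E: (word_phi a b) => [c|] // _; have [v [w [u [-> -> _ Eu]]]] := word_phiP E.
  have : phi X link w v by apply: phi_sym => //; rewrite Eu.
  by case Eu': (phi _ _ w v) => [u'|] // _; rewrite (word_phiE Eu').
by move=> a b; apply/idP/idP; apply: imp.
Qed.

End WordGraph.

(** * The algorithm of the pairing function *)

Lemma dsize_fst (A B : encType) (z : A * B) : dsize (enc z.1) <= dsize (enc z).
Proof. by case: z => a b; rewrite dsize_pair leqW ?leq_addr. Qed.

(** On the code of [(z, o)] the input is kept and an answer appended. The tail is the code of [o]: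
    it is [DNil] iff there is no query, and otherwise its head is the code of the queried term. *)
Definition call (p : prog) : prog :=
  PPair PId (PIf PTail (PSeq PTail (PSeq PHead p)) (PConst DNil)).

Lemma runs_poly_call (Z : encType) (I : Type) (D : I -> Prop) (len : I -> nat)
    (p : I -> prog) (z : I -> Z) (o : I -> option term) (ans : I -> term -> data) :
  poly_bounded D len (fun i => dsize (enc (z i, o i))) ->
  (exists2 T, poly_bounded D len T & forall i t, D i -> o i = Some t ->
     runs_in (p i) (enc t) (ans i t) (T i)) ->
  runs_poly D len (fun i => call (p i)) (fun i => enc (z i, o i))
    (fun i => enc (z i, o i, ans_at (ans i) (o i))).
Proof.
move=> bz [T bT TP].
apply: (runs_poly_pair (y := fun i => enc (z i, o i))); first exact: runs_poly_id.
apply: (runs_poly_if (runs_poly_tail bz)) => /=.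
  set D' := fun i => _.
  have subD i : D' i -> D i by case.
  have bz' : poly_bounded D' len (fun i => dsize (enc (z i, o i))).
    by case: bz => c cP; exists c => i /subD; apply: cP.
  have rt := runs_poly_tail bz'.
  apply: (runs_poly_seq rt).
  have rh := runs_poly_head (runs_poly_out rt).
  apply: (runs_poly_seq rh).
  exists T; first by case: bT => c cP; exists c => i /subD; apply: cP.
  by move=> i [Di]; case Eo: (o i) => [t|] //= _; apply: TP.
apply: (runs_poly_eq (y := fun=> DNil)); first by move=> i [_]; case: (o i).
apply: (runs_poly_const (d := fun=> DNil)); last exact: pbounded_const.
by case: bz => c cP; exists c => i [/cP].
Qed.

(** The computation is cut at the two calls, so that each stage is a [ptime] function; the answers
    accumulate in the state. *)
Definition stage1 (z : instance * (seq bool * seq bool)) :=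
  (z, query1 z.1 z.2.1).

Definition stage2 (z : instance * (seq bool * seq bool) * option term * data) :=
  (z.1.1, z.2, query2 z.1.1.1 z.2).

Definition stage3 (z : instance * (seq bool * seq bool) * data * option term * data) :=
  answer z.1.1.1.1 z.1.1.1.2.1 z.1.1.1.2.2 z.1.1.2 z.2.

Lemma ptime_stage1 : ptime stage1.
Proof. by rewrite /stage1; refine (ptime_pair _ (ptime_comp2 ptime_query1 _ _)); pt. Qed.

Lemma ptime_stage2 : ptime stage2.
Proof. by rewrite /stage2; refine (ptime_pair _ (ptime_comp2 ptime_query2 _ _)); pt. Qed.

Lemma ptime_stage3 : ptime stage3.
Proof.
by apply: (ptime_comp ptime_answer (f := fun z => (z.1.1.1.1, z.1.1.1.2, (z.1.1.2, z.2)))); pt.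
Qed.

Section Algorithm.
Variables p1 p2 p3 : prog.

Definition algorithm (d : data) (p : prog) : prog :=
  PSeq (PPair (PConst d) PId)
    (PSeq p1 (PSeq (call p) (PSeq p2 (PSeq (call p) p3)))).

(** The reduction receives the pairing program only as a code and must produce the code of the
    algorithm; the numbers are the tags of [enc_prog]. *)
Definition call_code (c : data) : data :=
  DCons (enc 5) (DCons (enc_prog PId)
    (DCons (enc 7) (DCons (enc_prog PTail) (DCons
      (DCons (enc 6) (DCons (enc_prog PTail)
        (DCons (enc 6) (DCons (enc_prog PHead) c))))
      (enc_prog (PConst DNil)))))).

Definition seq_code (c c' : data) : data := DCons (enc 6) (DCons c c').

Definition algorithm_code (d c : data) : data :=
  seq_code (DCons (enc 5) (DCons (DCons (enc 1) d) (enc_prog PId)))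
    (seq_code (enc_prog p1) (seq_code (call_code c)
      (seq_code (enc_prog p2) (seq_code (call_code c) (enc_prog p3))))).

Lemma enc_algorithm d p : enc_prog (algorithm d p) = algorithm_code d (enc_prog p).
Proof. by []. Qed.

Hypothesis run1 : forall (I : Type) (D : I -> Prop) (len : I -> nat) x,
  poly_bounded D len (fun i => dsize (enc (x i))) ->
  runs_poly D len (fun=> p1) (fun i => enc (x i)) (fun i => enc (stage1 (x i))).
Hypothesis run2 : forall (I : Type) (D : I -> Prop) (len : I -> nat) x,
  poly_bounded D len (fun i => dsize (enc (x i))) ->
  runs_poly D len (fun=> p2) (fun i => enc (x i)) (fun i => enc (stage2 (x i))).
Hypothesis run3 : forall (I : Type) (D : I -> Prop) (len : I -> nat) x,
  poly_bounded D len (fun i => dsize (enc (x i))) ->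
  runs_poly D len (fun=> p3) (fun i => enc (x i)) (fun i => enc (stage3 (x i))).

Lemma runs_algorithm (q : {poly nat}) : exists r : {poly nat},
  forall x, cn_valid x q -> forall v w : word 2 (word_len (inst_of x)),
    runs_in (algorithm (cn_enc x) (cn_pairing x)) (DCons (enc_word v) (enc_word w))
      (enc_option (@enc_word 2 _) (word_phi v w)) (r.[word_len (inst_of x)])%R.
Proof.
(* The family consists of all instances with two query words, measured by word length; one
   polynomial for the family is uniform in the instance. *)
pose I := {x : cn_input & (word 2 (word_len (inst_of x)) * word 2 (word_len (inst_of x)))%type}.
pose X (i : I) := inst_of (projT1 i).
pose D (i : I) := cn_valid (projT1 i) q.
pose len (i : I) := word_len (X i).
pose w1 (i : I) := bits_of (projT2 i).1.
pose w2 (i : I) := bits_of (projT2 i).2.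
pose ans (i : I) := pairing_output (projT1 i).
pose z (i : I) := (X i, (w1 i, w2 i)).
have bX : poly_bounded D len (fun i => dsize (enc (X i))).
  apply: pbounded_le (pbounded_len D len) => i _.
  by rewrite /len /word_len; lia.
have bw : poly_bounded D len (fun i => dsize (enc (w1 i, w2 i))).
  have bl : poly_bounded D len (fun i => 8 * len i + 3).
    apply: pbounded_add; last exact: pbounded_const.
    by apply: pbounded_mul; [exact: pbounded_const | exact: pbounded_len].
  apply: pbounded_le bl => i _; rewrite dsize_pair.
  have le_w1 : dsize (enc (w1 i)) <= 4 * len i + 1 := dsize_bits_of _.
  have le_w2 : dsize (enc (w2 i)) <= 4 * len i + 1 := dsize_bits_of _.
  by lia.
have callP (o : I -> option term) :
    (forall i t, o i = Some t -> is_occurrence (X i) t) ->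
    exists2 T, poly_bounded D len T & forall i t, D i -> o i = Some t ->
      runs_in (cn_pairing (projT1 i)) (enc t) (ans i t) (T i).
  (* The given time bound is [q] at the number of variables, which is at most the word length, and
     [q] is monotone. *)
  move=> occ; exists (fun i => q.[len i])%R.
    by apply: pbounded_horner; exact: pbounded_len.
  move=> i t [_ _ /(_ t) run _] /occ/occurrence_inst/run[d [k ev le_k]].
  exists k; first by rewrite /ans (pairing_outputP ev).
  apply: leq_trans le_k (horner_nat_mono _ _).
  have le_m : dsize (enc (cn_m (projT1 i))) <= dsize (enc (X i)) := dsize_fst (X i).
  by move: le_m; rewrite dsize_nat; move: (cn_m _) => k'; rewrite /len /word_len; lia.
pose o1 i := query1 (X i) (w1 i).
pose d1 i := ans_at (ans i) (o1 i).
pose o2 i := query2 (X i) (d1 i).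
pose d2 i := ans_at (ans i) (o2 i).
have occ1 i t : o1 i = Some t -> is_occurrence (X i) t.
  rewrite /o1 /query1; case: word_node => // v; case: linked_term => // t'.
  by case: ifP => // occ [<-].
have occ2 i t : o2 i = Some t -> is_occurrence (X i) t.
  rewrite /o2 /query2; case: dec_if => // t'.
  by case: ifP => // occ [<-].
have r0 : runs_poly D len (fun i => PPair (PConst (enc (X i))) PId)
    (fun i => enc (w1 i, w2 i)) (fun i => enc (z i)).
  by apply: runs_poly_pair; [exact: runs_poly_const | exact: runs_poly_id].
have r1 := run1 (runs_poly_out r0).
have c1 := runs_poly_call (z := z) (runs_poly_out r1) (callP o1 occ1).
have r2 := run2 (x := fun i => (z i, o1 i, d1 i)) (runs_poly_out c1).
have c2 := runs_poly_call (z := fun i => (z i, d1 i)) (runs_poly_out r2) (callP o2 occ2).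
have r3 := run3 (x := fun i => (z i, d1 i, o2 i, d2 i)) (runs_poly_out c2).
have [T [r rP] TP] := runs_poly_seq r0 (runs_poly_seq r1 (runs_poly_seq c1
  (runs_poly_seq r2 (runs_poly_seq c2 r3)))).
exists r => x valid_x v w; pose i : I := existT _ x (v, w).
have [t ev le_t] := TP i valid_x; exists t; last exact: leq_trans le_t (rP i valid_x).
rewrite -!enc_bits_of -enc_inst_of.
suff -> : enc_option (@enc_word 2 _) (word_phi v w) =
    enc (stage3 (z i, d1 i, o2 i, d2 i)) by exact: ev.
rewrite /stage3 /= /d2 /o2 /d1 /o1 /ans /= answer_spec /word_phi /vertex_of.
rewrite -/(w1 i) -/(w2 i); case: (word_node _ (w1 i)) => [v'|] //.
case: (word_node _ (w2 i)) => [w'|] //; case: (phi _ _ _ _) => [u|] //.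
by rewrite /= -enc_bits_of bits_vertex_word.
Qed.

End Algorithm.

(** * The reduction *)

Lemma ptimeP (A B : encType) (f : A -> B) : ptime f ->
  exists p (c : {poly nat}),
    forall x, runs_in p (enc x) (enc (f x)) (c.[dsize (enc x)])%R.
Proof.
case=> p [T [c cP] TP]; exists p, c => x; have [t ev le_t] := TP x Logic.I.
by exists t => //; apply: leq_trans le_t (cP x Logic.I).
Qed.

Definition reduced (p1 p2 p3 : prog) (X : instance) : nat * (data * (seq bool * seq bool)) :=
  (word_len X,
    (algorithm_code p1 p2 p3 (enc X) X.2.2.1,
      (pad (word_len X) (enc (Term X.2.2.2)), pad (word_len X) (enc (all_ones X))))).

Lemma ptime_reduced p1 p2 p3 : ptime (reduced p1 p2 p3).
Proof.
pose h := ptime_all_ones.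
rewrite /reduced /algorithm_code /seq_code /call_code.
by pt; refine (ptime_enc (ptime_comp h _)); pt.
Qed.

(** An unlinked occurrence is reported with the exceptional one, and [Leaf] is used here only for
    its code, which is that of a pairing violation. Any other term left alone reports its block,
    with the tag 1 of a degree violation. *)
Definition recovered (z : instance * (seq bool * seq bool)) : data :=
  if word_node (word_len z.1) z.2.1 is Some v then
    match v with
    | Point s => enc (Point s)
    | Term t =>
        if is_occurrence z.1 t then enc (Leaf t z.1.2.2.2) else DCons (enc 1) (enc t.1)
    | Leaf t t' => enc (Leaf t t')
    end
  else DNil.

Lemma ptime_recovered : ptime recovered.
Proof.
rewrite /recovered; refine (ptime_case_option _ _ _); [by pt | exact: ptime_const |].
by refine (ptime_case_node _ _ _ _); pt.
Qed.

Section Solutions.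
Variables (q : {poly nat}) (x : cn_input).
Hypothesis valid_x : cn_valid x q.
Local Notation X := (inst_of x).
Local Notation link := (link_of X (pairing_output x)).

Lemma pairing_output_eval t : occurrence x t ->
  exists k, eval (cn_pairing x) (enc_term t) (pairing_output x t) k.
Proof.
have [_ _ run _] := valid_x => /run[d [k ev _]].
by exists k; rewrite (pairing_outputP ev).
Qed.

Lemma paired_toP t t' : occurrence x t ->
  paired_to x t t' <->
  [/\ occurrence x t', t' <> t, t' <> cn_exc x & pairing_output x t = enc t'].
Proof.
move=> occ_t; split=> -[occ_t' ne_t ne_exc].
  by case=> k /pairing_outputP.
by move=> Et; split=> //; have := pairing_output_eval occ_t; rewrite Et.
Qed.

(** A partner in the sense of [paired_to] would pass all the tests of [link_of] and produce a
    link. *)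
Lemma link_None t : occurrence x t -> t <> cn_exc x -> link t = None ->
  ~ exists t', paired_to x t t'.
Proof.
move=> occ_t ne_exc + [t' /(paired_toP _ occ_t)[occ_t' ne_t ne_exc' Et]].
rewrite /link_of (_ : dec_if _ _ = Some t'); last exact/(dec_ifP _ _ dec_termK).
rewrite (occurrence_inst x t).2 // (occurrence_inst x t').2 //.
by move/eqP: ne_exc; move/eqP: ne_exc'; move/eqP: ne_t => /= -> -> ->.
Qed.

(** A leaf arises only when the program sends [t] to an admissible [t'] and its answer at [t'] is
    not [t]; as the program is deterministic, [t'] is then not paired to [t]. *)
Lemma link_Leaf t t' : link t = Some (Leaf t t') -> pairing_failure x t t'.
Proof.
rewrite /link_of; case: ifP => // /andP[/occurrence_inst occ_t /eqP ne_exc].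
case Et1: (dec_if _ _) => [t1|] //.
case: ifP => // /and3P[/occurrence_inst occ_t1 /eqP ne_t /eqP ne_exc'].
case: eqP => // ne_ans E; have {E}-> : t' = t1 by case: E.
have {}Et1 : pairing_output x t = enc t1 by apply/(dec_ifP _ _ dec_termK).
split=> //; first by move=> Et; case: ne_t.
by right; split; [apply/paired_toP | move=> /(paired_toP _ occ_t1)[_ _ _ /ne_ans]].
Qed.

Lemma recovered_solution (a b : word 2 (word_len X)) :
  word_phi a b = Some b -> a <> vertex_word x (Term (cn_exc x)) ->
  exists s : cn_cand x, cn_solution s /\
    recovered (X, (bits_of a, bits_of b)) = cn_enc_cand s.
Proof.
have link_occ := @link_of_occ X (pairing_output x).
have linkP := @link_ofP X (pairing_output x).
move=> /word_phiP[v [w [u [-> Ew Eu phi_v]]]] ne_eps.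
have [Vv Vw Vu] := phi_vertices phi_v.
have {Ew Eu} Eu : u = w by apply: (vertex_word_inj Vu Vw); rewrite -Eu -Ew.
rewrite {}Eu {u Vu} in phi_v *.
rewrite /recovered -[word_node _ _]/(vertex_of (vertex_word x v)) vertex_wordK //.
case: v => [s|t|t t'] in phi_v ne_eps Vv *.
- have /eqP szs := Vv; have [odd_F _] := phi_fix_point phi_v.
  (* Every boolean list of length [m] comes from a point over the two-element field. *)
  have [v Es] : exists v : (cn_m x).-tuple 'F_2, point_of_tuple v = s.
    exists [tuple ((nth false s i)%:R : 'F_2)%R | i < cn_m x].
    apply: (@eq_from_nth _ false); rewrite size_map size_tuple // => i lt_i.
    rewrite (nth_map 0%R) ?size_tuple // -[i]/(val (Ordinal lt_i)) -tnth_nth tnth_mktuple.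
    by case: nth.
  exists (NonzeroPoint v); split.
    by rewrite /= cn_poly_value Es odd_F; apply/eqP; exact: oner_neq0.
  rewrite -[LHS]/(DCons (enc 0) (enc s)) -Es.
  rewrite -[RHS]/(DCons (enc 0) (enc_seq (fun a : 'F_2 => enc_nat (val a)) v)).
  congr DCons; rewrite -[LHS]/(enc_seq enc _) enc_seq_map; apply: enc_seq_eq.
  by case=> -[|[|//]].
- have [term_t link_t full_t _] := phi_fix_term linkP phi_v.
  have ne_exc : t <> cn_exc x by move=> Et; case: ne_eps; rewrite Et.
  case: ifP => [/occurrence_inst occ_t|nocc_t].
    exists (PairingViolation x t (cn_exc x)); split=> //; split=> //.
      by have [] := valid_x.
    by left; split=> //; apply: link_None.
  exists (DegreeViolation x t.1); split=> //.
  apply: (degree_violation valid_x) => //; first exact/is_term_inst.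
  by move=> /occurrence_inst; rewrite nocc_t.
- have [link_t _] := phi_fix_leaf phi_v.
  by exists (PairingViolation x t t'); split=> //; apply: link_Leaf.
Qed.

End Solutions.

Lemma poly_reducible_end_of_the_line (q : {poly nat}) :
  exists (sigma : nat) (r : {poly nat}),
    poly_reducible (comb_nullstellensatz_F2 q) (end_of_the_line sigma r).
Proof.
have [p1 run1] := ptime_runs ptime_stage1.
have [p2 run2] := ptime_runs ptime_stage2.
have [p3 run3] := ptime_runs ptime_stage3.
have [r rP] := runs_algorithm run1 run2 run3 q.
have [P [cP runP]] := ptimeP (ptime_reduced p1 p2 p3).
have [Q [cQ runQ]] := ptimeP ptime_recovered.
exists 2, r, P, Q, (cP + cQ)%R => x valid_x; pose X := inst_of x.
(* All words are taken as nodes, so membership in the node set needs no test. *)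
pose y := @ElInput 2 (word_len X) [set: word 2 (word_len X)]
  (fun v w => @word_phi x v w : bool) (@word_phi x)
  (algorithm p1 p2 p3 (cn_enc x) (cn_pairing x))
  (vertex_word x (Term (cn_exc x))) (vertex_word x (all_ones X)).
have pairing_y := word_pairing_function x.
have fix_eps : word_phi (el_eps y) (el_delta y) = Some (el_delta y).
  apply: word_phiE; apply: phi_ones; last exact: link_of_exc.
  by apply/occurrence_inst; have [] := valid_x.
(* One polynomial has to bound both programs of the reduction; the sum of their bounds is used. *)
have runs_mono p a b (c d : {poly nat}) n : runs_in p a b (c.[n])%R ->
    runs_in p a b ((c + d)%R.[n])%R /\ runs_in p a b ((d + c)%R.[n])%R.
  by case=> t ev le_t; split; exists t => //; rewrite horner_natD; lia.
have Eenc : el_enc y = enc (reduced p1 p2 p3 X).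
  rewrite /reduced -(bits_vertex_word x (Term _)) -(bits_vertex_word x (all_ones X)).
  rewrite -[RHS]/(DCons _ (DCons _ (DCons (enc (bits_of _)) (enc (bits_of _))))).
  by rewrite !enc_bits_of enc_inst_of -enc_algorithm.
exists y; split.
- split=> //; last by split=> //; rewrite ?inE //; exact: degree_odd fix_eps.
    split; [exact: word_phi_irrefl | exact: word_phi_sym |].
    by move=> v w; rewrite !inE.
  exact: rP.
- rewrite /= Eenc; have := runP X; rewrite enc_inst_of.
  by move=> /(runs_mono _ _ _ _ cQ)[].
- move=> [a b] [/= _ /eqP ne_eps _ fix_a].
  have [s [sol_s Es]] := recovered_solution valid_x fix_a ne_eps.
  exists s; split=> //.
  have := (runs_mono _ _ _ _ cP _ (runQ (X, (bits_of a, bits_of b)))).2.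
  rewrite -[enc (X, _)]/(DCons (enc X) (DCons (enc (bits_of a)) (enc (bits_of b)))).
  by rewrite Es enc_inst_of !enc_bits_of.
Qed.

Theorem theorem18 (q : {poly nat}) :
  (exists (sigma : nat) (r : {poly nat}),
     poly_reducible (comb_nullstellensatz_F2 q) (end_of_the_line sigma r)) /\
  PPA (comb_nullstellensatz_F2 q).
Proof. by split; exact: poly_reducible_end_of_the_line. Qed.
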